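(* Let $n \geq 2$ be an integer. If $\varphi$ is an edge precoloring of $n$ edges of $K_{n,n} \square K_2$ using colors from $\{1,\dots,n+1\}$, then $\varphi$ can be extended to a proper $(n+1)$-edge coloring of $K_{n,n} \square K_2$.
   Context: $G \square H$ denotes the cartesian product of graphs $G$ and $H$. An edge precoloring of a graph is a proper edge coloring of some subset of its edges. A precoloring $\varphi$ is extended by a proper $t$-edge coloring $f$ (colors $\{1,\dots,t\}$) if $f(e)=\varphi(e)$ for every edge $e$ colored under $\varphi$. *)

(* Defs.v *)
From mathcomp Require Import all_boot.

Set Implicit Arguments.
Unset Strict Implicit.
Unset Printing Implicit Defensive.

Record sgraph := SGraph {
  vertex :> finType;
  adj : rel vertex;
  adj_sym : symmetric adj;
  adj_irrefl : irreflexive adj }.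

Definition edges (G : sgraph) : {set {set G}} :=
  [set [set p.1; p.2] | p : G * G & adj p.1 p.2].

Definition complete_rel n : rel 'I_n := fun x y => x != y.

Lemma complete_sym n : symmetric (@complete_rel n).
Proof. by move=> x y; rewrite /complete_rel eq_sym. Qed.

Lemma complete_irrefl n : irreflexive (@complete_rel n).
Proof. by move=> x; rewrite /complete_rel eqxx. Qed.

Definition complete n : sgraph :=
  SGraph (@complete_sym n) (@complete_irrefl n).

Definition complete_bipartite_rel m n : rel ('I_m + 'I_n) :=
  fun x y => match x, y with
             | inl _, inr _ | inr _, inl _ => true
             | _, _ => false
             end.

Lemma complete_bipartite_sym m n : symmetric (@complete_bipartite_rel m n).
Proof. by move=> [x|x] [y|y]. Qed.

Lemma complete_bipartite_irrefl m n :
  irreflexive (@complete_bipartite_rel m n).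
Proof. by case. Qed.

Definition complete_bipartite m n : sgraph :=
  SGraph (@complete_bipartite_sym m n) (@complete_bipartite_irrefl m n).

Definition cartesian_rel (G H : sgraph) : rel (G * H) :=
  fun x y => (x.1 == y.1) && adj x.2 y.2 || (x.2 == y.2) && adj x.1 y.1.

Lemma cartesian_sym G H : symmetric (@cartesian_rel G H).
Proof.
move=> x y; rewrite /cartesian_rel (eq_sym x.1) (eq_sym x.2).
by rewrite (@adj_sym H) (@adj_sym G).
Qed.

Lemma cartesian_irrefl G H : irreflexive (@cartesian_rel G H).
Proof. by move=> x; rewrite /cartesian_rel !adj_irrefl !andbF. Qed.

Definition cartesian (G H : sgraph) : sgraph :=
  SGraph (@cartesian_sym G H) (@cartesian_irrefl G H).

Definition adjacent_edges (G : sgraph) (e e' : {set G}) : bool :=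
  (e != e') && (e :&: e' != set0).

Definition proper_on (G : sgraph) (C : eqType) (S : {set {set G}})
    (f : {set G} -> C) : Prop :=
  {in S &, forall e e', adjacent_edges e e' -> f e != f e'}.

(* The t colors are the elements of 'I_t; the values of f outside
   [edges G] are irrelevant. *)
Definition proper_edge_coloring (G : sgraph) (t : nat)
    (f : {set G} -> 'I_t) : Prop :=
  proper_on (edges G) f.

(* [None] means uncolored. *)
Definition precolored (G : sgraph) (t : nat)
    (phi : {set G} -> option 'I_t) : {set {set G}} :=
  [set e | phi e != None].

Definition edge_precoloring (G : sgraph) (t : nat)
    (phi : {set G} -> option 'I_t) : Prop :=
  precolored phi \subset edges G /\ proper_on (precolored phi) phi.

Definition extends (G : sgraph) (t : nat)
    (f : {set G} -> 'I_t) (phi : {set G} -> option 'I_t) : Prop :=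
  {in precolored phi, forall e, phi e = Some (f e)}.

(* Main.v *)
Require Import Defs.
From mathcomp Require Import all_boot zify.

(** The edges of K_{n,n} # K_2 are two copies of an n x n array together with
    one "vertical" edge per row and per column.  If both copies contain
    precolored edges, some color z occurs in neither.  A vertical edge
    precolored c <> z in row x is simulated by putting c in a cell (x, y) of
    both copies, with column y otherwise untouched.  Each copy then has fewer
    than n filled cells, hence completes to a Latin square in the n colors other
    than z (Smetaniuk's theorem).  Give z to the vertical edges and exchange the
    two colors on the 4-cycles through the simulating cells.

    If one copy carries no precolored edge, use the same array on both copies;
    the array must then omit prescribed colors from prescribed rows and columns.
    This goes by induction on n.  A color seen only on vertical edges can serve
    as z above; a color used exactly once, on a cell, is removed by
    Smetaniuk's construction, which preserves the color sets of the old rows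
    and columns; and if neither occurs, the simulation yields at most n cells
    in which no color occurs exactly once, which can be completed color by
    color, the most frequent first, with Hall's theorem.  With no precolored
    vertical edge, Smetaniuk's theorem for order n + 1 applies. *)

Set Implicit Arguments.
Unset Strict Implicit.
Unset Printing Implicit Defensive.

(** Discards hypotheses of non-arithmetic shape first, sparing [lia] the large contexts. *)
Ltac nat_lia := repeat match goal with
  | H : ?T |- _ => lazymatch T with
    | is_true (leq _ _) => fail
    | @eq nat _ _ => fail
    | is_true (negb (@eq_op ?E _ _)) => unify (Equality.sort E) nat; fail 1
    | _ => clear H
    end
  end; lia.

(** * Hall's theorem *)

(** Induction on [#|A|]. If some nonempty proper [S] is tight, [S] and [A :\: S] are matched
    separately; otherwise [x0] can be matched first, with any of its neighbors. [y0] is the value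
    used when [A] is empty. *)
Lemma hall (X Y : finType) (y0 : Y) (A : {set X}) (N : X -> {set Y}) :
  (forall S : {set X}, S \subset A -> #|S| <= #|\bigcup_(x in S) N x|) ->
  exists2 h : X -> Y, {in A &, injective h} & {in A, forall x, h x \in N x}.
Proof.
have [k leAk] := ubnP #|A|; elim: k => // k IHk in A N leAk *.
move=> hallN; have [->|[x0 Ax0]] := set_0Vmem A.
  by exists (fun=> y0) => x; rewrite inE.
case: (pickP [pred S : {set X} | [&& S \proper A, S != set0 &
  #|\bigcup_(x in S) N x| <= #|S|]]) => [S /and3P[ltSA S_neq0 tight]|slack].
- have ltS := proper_card ltSA; have sSA := proper_sub ltSA.
  have [||h1 inj1 N1] := IHk S N; first by lia.
    by move=> T sTS; apply: hallN; apply: subset_trans sSA.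
  pose B := \bigcup_(x in S) N x.
  have cAS : #|A :\: S| = #|A| - #|S| by rewrite cardsD (setIidPr sSA).
  have Spos : 0 < #|S| by rewrite card_gt0.
  (* The rest must avoid the neighborhood [B] of [S]. Hall's condition for [T :|: S], less the at
     most [#|S|] elements of [B], is the condition for [T]. *)
  have [||h2 inj2 N2] := IHk (A :\: S) (fun x => N x :\: B); first by lia.
    move=> T sT; have sTA : T \subset A.
      by apply: subset_trans sT _; apply: subsetDl.
    have disTS : [disjoint T & S].
      apply/pred0P => x /=; apply/negP => /andP[/(subsetP sT)].
      by rewrite inE => /andP[/negP].
    have := hallN (T :|: S); rewrite subUset sTA sSA => /(_ isT).
    rewrite bigcup_setU cardsU (disjoint_setI0 disTS) cards0 subn0.
    have -> : \bigcup_(x in T) (N x :\: B) = (\bigcup_(x in T) N x) :\: B.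
      apply/setP => y; rewrite inE; apply/bigcupP/andP => [[x Tx]|].
        by rewrite inE => /andP[-> Ny]; split=> //; apply/bigcupP; exists x.
      by case=> By /bigcupP[x Tx Ny]; exists x; rewrite // inE By.
    have := cardsUI (\bigcup_(x in T) N x) B.
    have := cardsID B (\bigcup_(x in T) N x).
    rewrite -/B in tight *; have := cardsU (\bigcup_(x in T) N x) B; lia.
  exists (fun x => if x \in S then h1 x else h2 x) => [x y Ax Ay|x Ax].
    case: ifPn => Sx; case: ifPn => Sy.
    + exact: inj1.
    + move=> e; have := N2 y; rewrite !inE Sy Ay -e => /(_ isT) /andP[/negP[]].
      by apply/bigcupP; exists x => //; apply: N1.
    + move=> e; have := N2 x; rewrite !inE Sx Ax e => /(_ isT) /andP[/negP[]].
      by apply/bigcupP; exists y => //; apply: N1.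
    + by apply: inj2; rewrite inE ?Sx ?Sy.
  case: ifPn => Sx; first exact: N1.
  by have := N2 x; rewrite !inE Sx Ax => /(_ isT) /andP[].
- have := hallN [set x0]; rewrite sub1set Ax0 cards1 big_set1 => /(_ isT).
  case/card_gt0P => y Ny.
  have cA : #|A| = #|A :\ x0|.+1 by rewrite (cardsD1 x0 A) Ax0.
  (* With no tight set, each nonempty [T] has a neighbor to spare, so it can afford to lose [y]. *)
  have [||h injh Nh] := IHk (A :\ x0) (fun x => N x :\ y); first by lia.
    move=> T sT; have [->|Tneq0] := eqVneq T set0; first by rewrite cards0.
    have pTA : T \proper A.
      by apply: sub_proper_trans sT _; apply: properD1.
    have := slack T; rewrite /= pTA Tneq0 /= => /negbT; rewrite -ltnNge => lt.
    have -> : \bigcup_(x in T) (N x :\ y) = (\bigcup_(x in T) N x) :\ y.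
      apply/setP => w; rewrite !inE; apply/bigcupP/andP => [[x Tx]|].
        by rewrite !inE => /andP[-> Nw]; split=> //; apply/bigcupP; exists x.
      by case=> wy /bigcupP[x Tx Nw]; exists x; rewrite // !inE wy.
    have := cardsD1 y (\bigcup_(x in T) N x); case: (_ \in _) => /=; lia.
  have hy x : x \in A -> x != x0 -> h x != y /\ h x \in N x.
    by move=> Ax xx0; have := Nh x; rewrite !inE xx0 Ax => /(_ isT) /andP[].
  exists (fun x => if x == x0 then y else h x) => [u v Au Av|x Ax].
    case: eqVneq => [->|uu]; case: eqVneq => [->|vv] //.
    + by move=> e; case: (hy v Av vv) => /eqP[]. 
    + by move=> e; case: (hy u Au uu) => /eqP[].
    + by apply: injh; rewrite !inE ?uu ?vv.
  by case: eqVneq => [->|xx] //; case: (hy x Ax xx).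
Qed.

(** * Smetaniuk's construction *)

(* [c] is a row of a Latin square and [d j] a symbol missing from column [j].
   The entry of column [j0] is expelled; it may have to enter some column [j]
   with [d j] equal to it, expelling the entry there, and so on along a chain
   which ends with a symbol [y] outside the range of [d]. *)
Lemma swap_chain (J Z : eqType) (H : seq J) (j0 : J) (c d : J -> Z) :
    uniq (j0 :: H) -> {in j0 :: H &, injective c} -> {in H &, injective d} ->
  exists (S : pred J) (y : Z),
    let place j := if S j then d j else c j in
    let d' j := if (j == j0) || S j then c j else d j in
    [/\ {in H &, injective place}, {in H, forall j, place j != y},
        {in H, forall j, place j \in map c (j0 :: H)},
        y \in map c (j0 :: H) &
     [/\ y \notin map d H, {in j0 :: H &, injective d'} &
        map d' (j0 :: H) =i y :: map d H]].
Proof.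
have [k] := ubnP (size H); elim: k => // k IHk in H j0 *.
move=> ltk /= /andP[j0H uH] cinj dinj.
(* If no column of [H] lacks [c j0], the chain ends at once with [y = c j0]. *)
have [|cj0] := boolP (c j0 \in map d H); last first.
  have nj0 j : j \in H -> (j == j0) = false.
    by move=> Hj; apply: contraNF j0H => /eqP <-.
  exists pred0, (c j0); split=> //=.
  - by move=> u v Hu Hv; apply: cinj; rewrite inE ?Hu ?Hv orbT.
  - move=> j Hj; apply/eqP => /cinj; rewrite !inE eqxx Hj orbT => /(_ isT isT) e.
    by rewrite -e Hj in j0H.
  - by move=> j Hj; rewrite inE map_f ?orbT.
  - by rewrite inE eqxx.
  split=> //.
  - move=> u v; rewrite !inE !orbF.
    case: eqP => [->|_]; case: eqP => [->|_] //=.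
    + by move=> _ Hv e; case/negP: cj0; rewrite e map_f.
    + by move=> Hu _ e; case/negP: cj0; rewrite -e map_f.
    + exact: dinj.
  move=> w; rewrite eqxx !inE; congr (_ || _).
  have -> // : [seq (if (j == j0) || false then c j else d j) | j <- H] = map d H.
  by apply/eq_in_map => j Hj; rewrite nj0.
(* Otherwise column [j1] takes [d j1 = c j0] and expels [c j1]; the chain goes on from [j1] through
   the other columns. *)
case/mapP=> j1 Hj1 cdj; pose H1 := rem j1 H.
have pH : perm_eq H (j1 :: H1) by apply: perm_to_rem.
have memH : H =i j1 :: H1 by apply: perm_mem.
have u1 : uniq (j1 :: H1) by rewrite -(perm_uniq pH).
have szH := perm_size pH.
have [||||S [y [pinj py pc yc [yd dinj' dy]]]] := IHk H1 j1 => //.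
- by rewrite szH /= in ltk; lia.
- by move=> u v; rewrite -!memH => Hu Hv; apply: cinj; rewrite inE ?Hu ?Hv orbT.
- by move=> u v Hu Hv; apply: dinj; rewrite memH inE ?Hu ?Hv orbT.
have cj0N : c j0 \notin map c (j1 :: H1).
  apply/mapP=> -[j]; rewrite -memH => Hj /cinj; rewrite !inE eqxx Hj orbT.
  by move=> /(_ isT isT) e; rewrite e Hj in j0H.
have nj0 j : j \in H -> (j == j0) = false.
  by move=> Hj; apply: contraNF j0H => /eqP <-.
have nj1 j : j \in H1 -> (j == j1) = false.
  by move=> Hj; case/andP: u1 => N1 _; apply: contraNF N1 => /eqP <-.
have dj1N : d j1 \notin y :: map d H1.
  rewrite inE negb_or -cdj; apply/andP; split.
    by apply: contraNneq cj0N => ->.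
  apply/mapP=> -[j Hj]; rewrite cdj => /dinj; rewrite !memH !inE eqxx Hj orbT.
  by move=> /(_ isT isT) /esym/eqP; rewrite nj1.
have yneq : y != d j1 by apply: contraNneq dj1N => ->; rewrite mem_head.
exists (fun j => (j == j1) || S j), y => /=.
have memc z : z \in map c (j1 :: H1) -> z \in c j0 :: map c H.
  by case/mapP=> j; rewrite -memH => Hj ->; rewrite inE map_f ?orbT.
have pl j : j \in H1 -> (if (j == j1) || S j then d j else c j)
   = (if S j then d j else c j) by move=> Hj; rewrite nj1.
split.
- move=> u v; rewrite !memH !inE.
  case: (eqVneq u j1) => [->|uj]; case: (eqVneq v j1) => [->|vj] //=.
  + move=> _ Hv e; case/negP: cj0N; rewrite cdj e; exact: pc.
  + move=> Hu _ e; case/negP: cj0N; rewrite cdj -e; exact: pc.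
  + exact: pinj.
- move=> j; rewrite memH inE; case: (eqVneq j j1) => [->|jj] //=.
    by move=> _; rewrite eq_sym.
  exact: py.
- move=> j; rewrite memH inE; case: (eqVneq j j1) => [->|jj] //=.
    by rewrite -cdj inE eqxx.
  by move=> /pc /memc.
- exact: memc.
have d1j j : j \in H -> 
  (if (j == j0) || ((j == j1) || S j) then c j else d j) =
  (if (j == j1) || S j then c j else d j) by move=> Hj; rewrite nj0.
split.
- apply/mapP=> -[j]; rewrite memH inE => /orP[/eqP->|Hj] e.
    by rewrite e eqxx in yneq.
  by case/negP: yd; rewrite e map_f.
- have cN j : j \in H -> c j0 <> (if (j == j1) || S j then c j else d j).
    move=> Hj e; case/negP: dj1N; rewrite -cdj e -dy.
    by apply: (map_f (fun j => if (j == j1) || S j then c j else d j));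
       rewrite -memH.
  move=> u v; rewrite !inE.
  case: (eqVneq u j0) => [->|uj]; case: (eqVneq v j0) => [->|vj] //=.
  + by move=> _ Hv /(cN _ Hv).
  + by move=> Hu _ /esym /(cN _ Hu).
  + by move=> Hu Hv; apply: dinj'; rewrite -memH.
move=> w; rewrite eqxx /= !inE.
rewrite ((eq_in_map (fun j => if (j == j0) || ((j == j1) || S j)
   then c j else d j) (fun j => if (j == j1) || S j then c j else d j) H).1 d1j).
rewrite (perm_mem (perm_map _ pH)) dy.
by rewrite (perm_mem (perm_map d pH)) /= !inE cdj orbCA.
Qed.

Section Smetaniuk.
Variables (Z : finType) (N : nat) (C : nat -> nat -> Z) (x : Z).
Hypothesis C_row : forall i j j', i < N -> j < N -> j' < N ->
  C i j = C i j' -> j = j'.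
Hypothesis C_col : forall j i i', j < N -> i < N -> i' < N ->
  C i j = C i' j -> i = i'.
Hypothesis C_old : forall i j, i < N -> j < N -> C i j != x.

(* [L] holds the first [r] rows of the enlarged square.  Column N - r < j < N has
   received the new symbol [x] and in exchange lost the symbol [d j] of [C]; the
   last column consists of [x] and of these lost symbols. *)
Record smetaniuk_rows (r : nat) (L : nat -> nat -> Z) (d : nat -> Z) : Prop := {
  sm_keep : forall i j, i < r -> i + j < N -> L i j = C i j;
  sm_diag : forall i, i < r -> L i (N - i) = x;
  sm_row : forall i j j', i < r -> j <= N -> j' <= N ->
    L i j = L i j' -> j = j';
  sm_rowset : forall i j, i < r -> j <= N -> L i j != x ->
    exists2 j', j' < N & L i j = C i j';
  sm_col : forall j i i', j <= N -> i < r -> i' < r ->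
    L i j = L i' j -> i = i';
  sm_colset : forall i j, i < r -> j < N -> L i j != x ->
    exists2 i', i' < r & L i j = C i' j;
  sm_disp : forall j, N - r < j < N -> exists2 i, i < r & d j = C i j;
  sm_dispN : forall i j, i < r -> N - r < j < N -> L i j <> d j;
  sm_disp_inj : forall j j', N - r < j < N -> N - r < j' < N ->
    d j = d j' -> j = j';
  sm_last : forall i, i < r -> L i N != x ->
    exists2 j, N - r < j < N & L i N = d j }.

Lemma smetaniuk_row0 : 0 < N ->
  smetaniuk_rows 1 (fun i j => if j == N then x else C i j) (fun=> x).
Proof.
move=> N0; have lt1 i : i < 1 -> i = 0 by case: i.
split=> /=; try by move=> *; exfalso; lia.
- by move=> i j /lt1-> lt; rewrite ifN //; lia.
- by move=> i /lt1->; rewrite subn0 eqxx.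
- move=> i j j' /lt1-> lej lej'.
  case: eqVneq => [->|nj]; case: eqVneq => [->|nj'] //.
  + by move=> e; case/eqP: (@C_old 0 j' N0 ltac:(lia)).
  + by move=> e; case/eqP: (@C_old 0 j N0 ltac:(lia)).
  + by apply: (@C_row 0); lia.
- move=> i j /lt1-> lej; case: (eqVneq j N) => [_|nj]; rewrite ?eqxx //.
  by exists j => //; lia.
- by move=> j i i' _ /lt1-> /lt1->.
- move=> i j /lt1-> lt _; exists 0; rewrite // ifN //; lia.
- by move=> i _; rewrite eqxx eqxx.
Qed.

(** Row [r] receives [x] in column [N - r]. The entry expelled there is pushed along a swap chain
    through the columns that already gave up a symbol. The symbol [y] at the end of the chain goes
    to the last column, where it is new because no column had lost it before. *)
Lemma smetaniuk_rowS r L d : 0 < r < N -> smetaniuk_rows r L d ->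
  exists L' d', smetaniuk_rows r.+1 L' d'.
Proof.
move=> /andP[r0 rN] [keep diag row rowset col colset disp dispN dinj last].
pose H := iota (N - r).+1 r.-1.
have memH j : (j \in H) = (N - r < j < N) by rewrite mem_iota; lia.
have memH0 j : (j \in N - r :: H) = (N - r <= j < N).
  by rewrite inE memH; lia.
have [|||S [y]] := @swap_chain _ _ H (N - r) (C r) d.
- rewrite /= iota_uniq andbT memH; lia.
- by move=> j j'; rewrite !memH0 => hj hj'; apply: C_row; lia.
- by move=> j j'; rewrite !memH; apply: dinj.
set pl := fun j => if S j then _ else _.
set d' := fun j => if (j == N - r) || S j then _ else _.
move=> [pinj py pc yc [yd d'inj d'E]].
have {}yd j : N - r < j < N -> d j <> y.
  by rewrite -memH => Hj e; case/negP: yd; rewrite -e map_f.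
have {}yc : exists2 j, N - r <= j < N & y = C r j.
  by case/mapP: yc => j; rewrite memH0; exists j.
have {}pc j : N - r < j < N -> exists2 j', N - r <= j' < N & pl j = C r j'.
  by rewrite -memH => /pc /mapP[j']; rewrite memH0; exists j'.
have {}py j : N - r < j < N -> pl j <> y.
  by rewrite -memH => /py/eqP.
have {}pinj j j' : N - r < j < N -> N - r < j' < N -> pl j = pl j' -> j = j'.
  by rewrite -!memH; apply: pinj.
have {}d'inj j j' : N - r <= j < N -> N - r <= j' < N -> d' j = d' j' -> j = j'.
  by rewrite -!memH0; apply: d'inj.
have d'y : exists2 j, N - r <= j < N & y = d' j.
  have : y \in map d' (N - r :: H) by rewrite d'E mem_head.
  by case/mapP=> j; rewrite memH0; exists j.
have d'd j0 : N - r < j0 < N -> exists2 j, N - r <= j < N & d j0 = d' j.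
  rewrite -memH => Hj0; have : d j0 \in map d' (N - r :: H).
    by rewrite d'E inE map_f ?orbT.
  by case/mapP=> j; rewrite memH0; exists j.
pose row_r j := if j < N - r then C r j else if j == N - r then x else
  if j == N then y else pl j.
pose L' i j := if i == r then row_r j else L i j.
have L'r j : L' r j = row_r j by rewrite /L' eqxx.
have L'E i j : i < r -> L' i j = L i j by move=> lt; rewrite /L' ifN //; lia.
have ltS i : i < r.+1 -> i = r \/ i < r by lia.
have rE1 j : j < N - r -> row_r j = C r j by rewrite /row_r => ->.
have rE2 : row_r (N - r) = x by rewrite /row_r ltnn eqxx.
have rE3 : row_r N = y by rewrite /row_r eqxx ifN ?ifN //; lia.
have rE4 j : N - r < j < N -> row_r j = pl j.
  by move=> hj; rewrite /row_r !ifN //; lia.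
have zone j : j <= N -> [\/ j < N - r, j = N - r, j = N | N - r < j < N].
  move=> le; case: (ltngtP j (N - r)) => [?|lt|?].
  - by constructor 1.
  - by case: (eqVneq j N) => ?; [constructor 3|constructor 4; lia].
  - by constructor 2.
(* Left of column [N - r] the row agrees with [C]; to the right it rearranges entries of [C] from
   columns [N - r] onwards. The two parts cannot collide. *)
have rset j : j <= N -> j <> N - r -> exists2 j', j' < N & row_r j = C r j' /\
    (j < N - r /\ j' = j \/ N - r <= j' /\ N - r < j).
  move=> /zone[lt|->//|->|hj] _.
  - by exists j; [lia|rewrite rE1 //; split=> //; left].
  - by case: yc => j' hj' e; exists j'; [lia|rewrite rE3; split=> //; right; lia].
  - by case: (pc j hj) => j' hj' e; exists j'; [lia|rewrite rE4 //; split=> //; right; lia].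
have rx j : j <= N -> row_r j = x -> j = N - r.
  move=> le e; apply/eqP/negPn/negP=> /eqP /(rset j le)[j' lt [e' _]].
  by case/eqP: (C_old rN lt); rewrite -e'.
have C_Lcol i j : i < r -> j < N -> L i j <> C r j.
  move=> lt ltj e; have nx : L i j != x by rewrite e C_old.
  have [i' lti'] := colset i j lt ltj nx; rewrite e => /C_col; lia.
have dC j : N - r < j < N -> d j <> C r j.
  by move=> hj e; have [i lti] := disp j hj; rewrite e => /C_col; lia.
have newcol i j : i < r -> j <= N -> L i j <> row_r j.
  move=> lti /zone[lt|->|->|hj].
  - by rewrite rE1 //; apply: C_Lcol; lia.
  - rewrite rE2 keep; [|lia..]; apply/eqP; apply: C_old; lia.
  - rewrite rE3 => e; have [j' hj' e'] : exists2 j, N - r <= j < N & y = C r j by [].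
    have nx : L i N != x by rewrite e e' C_old //; lia.
    have [j2 hj2] := last i lti nx; rewrite e => /esym; exact: yd.
  - rewrite rE4 // /pl; case: ifP => _; first exact: dispN.
    by apply: C_Lcol; lia.
exists L', d'; split.
- move=> i j /ltS[->|lti] lt; last by rewrite L'E // keep.
  by rewrite L'r rE1 //; lia.
- by move=> i /ltS[->|lti]; [rewrite L'r|rewrite L'E // diag].
- move=> i j j' /ltS[->|lti] lej lej'; last by rewrite !L'E //; apply: row.
  rewrite !L'r; case: (eqVneq j (N - r)) => [->|nj].
    by rewrite rE2 => /esym /rx ->.
  case: (eqVneq j' (N - r)) => [->|nj']; first by rewrite rE2 => /rx ->.
  have [k ltk [ek zk]] := rset j lej (elimN eqP nj).
  have [k' ltk' [ek' zk']] := rset j' lej' (elimN eqP nj').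
  rewrite ek ek' => /C_row ekk; have {}ekk : k = k' by apply: ekk; lia.
  case: zk => [[lt ekj]|[le lt]]; case: zk' => [[lt' ekj']|[le' lt']]; try lia.
  have e : row_r j = row_r j' by rewrite ek ek' ekk.
  have cse l : N - r < l -> l <= N -> l = N \/ N - r < l < N by lia.
  case: (cse j lt lej) => [ej|hj]; case: (cse j' lt' lej') => [ej'|hj'].
  + by rewrite ej ej'.
  + by move: e; rewrite ej rE3 rE4 // => /esym/(py _ hj').
  + by move: e; rewrite ej' rE3 rE4 // => /(py _ hj).
  + by move: e; rewrite !rE4 //; apply: pinj.
- move=> i j /ltS[->|lti] lej; last by rewrite L'E //; apply: rowset.
  rewrite L'r; case: (eqVneq j (N - r)) => [->|nj]; first by rewrite rE2 eqxx.
  by have [k ltk [ek _]] := rset j lej (elimN eqP nj); exists k.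
- move=> j i i' lej /ltS[->|lti] /ltS[->|lti'] //; rewrite ?L'r ?L'E //.
  + by move=> e; case: (newcol i' j).
  + by move=> e; case: (newcol i j).
  + exact: col.
- move=> i j /ltS[->|lti] lej; last first.
    rewrite L'E // => nx; have [i' lti' e] := colset i j lti lej nx.
    by exists i' => //; lia.
  rewrite L'r => nx; have lej' : j <= N by lia.
  case: (zone j lej') nx => [lt|->|ej|hj]; [|by rewrite rE2 eqxx|lia|].
    by rewrite rE1 //; exists r.
  rewrite rE4 // /pl; case: ifP => _ _; last by exists r.
  by have [i' lti' e] := disp j hj; exists i' => //; lia.
- move=> j hj; rewrite /d'; case: (eqVneq j (N - r)) => [_|nj] /=.
    by exists r.
  case: ifP => _; first by exists r.
  by have [|i' lti' e] := disp j; [lia|exists i' => //; lia].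
- move=> i j lti hj; rewrite /d'; case: (eqVneq j (N - r)) => [->|nj] /=.
    case: (ltS i lti) => [->|lti'].
      by rewrite L'r rE2; apply/eqP; rewrite eq_sym C_old //; lia.
    by rewrite L'E //; apply: C_Lcol; lia.
  have hj' : N - r < j < N by lia.
  case: (ltS i lti) => [->|lti'].
    rewrite L'r rE4 // /pl; case: ifP => _; first exact: dC.
    by move=> /esym; apply: dC.
  rewrite L'E //; case: ifP => _; last exact: dispN.
  by apply: C_Lcol; lia.
- by move=> j j' hj hj'; apply: d'inj; lia.
- move=> i /ltS[->|lti].
    by rewrite L'r rE3 => _; case: d'y => j hj e; exists j => //; lia.
  rewrite L'E // => nx; have [j hj ->] := last i lti nx.
  by have [j' hj' ->] := d'd j hj; exists j' => //; lia.
Qed.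

(** The last row consists of [x], of the lost symbols [d j], and of a corner entry. The corner must
    avoid [x] and the [N - 1] symbols [d j], which also make up the rest of the last column;
    [N < #|K|] leaves a choice in [K]. As this choice is arbitrary, color sets are controlled only
    in the rows and columns before the last. *)
Lemma smetaniuk_extend (K : {set Z}) : 0 < N -> N < #|K| ->
  exists L : nat -> nat -> Z,
  [/\ forall i j, i + j < N -> L i j = C i j,
      forall i, i <= N -> L i (N - i) = x,
      L N N \in K,
      forall i j j', i <= N -> j <= N -> j' <= N -> L i j = L i j' -> j = j' &
  [/\ forall j i i', j <= N -> i <= N -> i' <= N -> L i j = L i' j -> i = i',
      forall i j, i < N -> j <= N -> L i j != x ->
        exists2 j', j' < N & L i j = C i j' &
      forall i j, i <= N -> j < N -> L i j != x ->
        exists2 i', i' < N & L i j = C i' j]].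
Proof.
move=> N0 NZ.
have : forall r, 0 < r <= N -> exists L d, smetaniuk_rows r L d.
  elim=> // -[_ _|k IH /andP[_ leN]]; first by do 2 eexists; exact: smetaniuk_row0.
  by have [|L [d h]] := IH; [lia|apply: smetaniuk_rowS h; lia].
move=> /(_ N) [|L [d [keep diag row rowset col colset disp dispN dinj last]]].
  by lia.
rewrite subnn in disp dispN dinj last.
have [p [pK px pd]] : exists p, [/\ p \in K, p != x &
    forall j, 0 < j < N -> p <> d j].
  pose s := x :: [seq d j | j <- iota 1 N.-1].
  have [p ps|all_s] := pickP [pred p in K | p \notin s]; last first.
    suff : #|K| <= N by rewrite leqNgt NZ.
    have <- : size s = N by rewrite /s /= size_map size_iota; lia.
    apply: leq_trans (card_size s); apply: subset_leq_card.
    by apply/subsetP => p Kp; have := all_s p; rewrite /= Kp => /negbFE.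
  case/andP: ps => Kp; rewrite inE negb_or => /andP[px pd]; exists p; split=> // j hj e.
  by case/negP: pd; rewrite e map_f // mem_iota; lia.
pose rN j := if j == 0 then x else if j == N then p else d j.
pose L' i j := if i == N then rN j else L i j.
have rN0 : rN 0 = x by [].
have rNN : rN N = p by rewrite /rN eqxx ifN //; lia.
have rNd j : 0 < j < N -> rN j = d j.
  by move=> hj; rewrite /rN ifN ?ifN //; lia.
have L'N j : L' N j = rN j by rewrite /L' eqxx.
have L'E i j : i < N -> L' i j = L i j by move=> lt; rewrite /L' ifN //; lia.
have leS i : i <= N -> i = N \/ i < N by lia.
have zone j : j <= N -> [\/ j = 0, j = N | 0 < j < N].
  move=> le; case: (eqVneq j 0) => ?; first by constructor 1.
  by case: (eqVneq j N) => ?; [constructor 2|constructor 3; lia].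
have dx j : 0 < j < N -> d j <> x.
  move=> hj; have [i lti ->] := disp j hj; apply/eqP; apply: C_old; lia.
have newcol i j : i < N -> j <= N -> L i j <> rN j.
  move=> lti /zone[->|->|hj].
  - by rewrite rN0 keep ?addn0 //; apply/eqP/C_old.
  - rewrite rNN => e; have nx : L i N != x by rewrite e.
    by have [j' hj'] := last i lti nx; rewrite e; apply: pd.
  - by rewrite rNd //; apply: dispN.
exists L'; split.
- by move=> i j lt; rewrite L'E ?keep //; lia.
- by move=> i /leS[->|lti]; rewrite ?subnn ?L'N // L'E // diag.
- by rewrite L'N rNN.
- move=> i j j' /leS[->|lti] lej lej'; last by rewrite !L'E //; apply: row.
  rewrite !L'N; case: (zone j lej) => [->|->|hj];
    case: (zone j' lej') => [->|->|hj']; rewrite ?rN0 ?rNN ?rNd //.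
  + by move=> e; rewrite -e eqxx in px.
  + by move/esym/(dx _ hj').
  + by move=> e; rewrite e eqxx in px.
  + by move/(pd _ hj').
  + by move/(dx _ hj).
  + by move/esym/(pd _ hj).
  + exact: dinj.
split.
- move=> j i i' lej /leS[->|lti] /leS[->|lti'] //; rewrite ?L'N ?L'E //.
  + by move=> e; case: (newcol i' j).
  + by move=> e; case: (newcol i j).
  + exact: col.
- by move=> i j lti; rewrite L'E //; apply: rowset.
- move=> i j /leS[->|lti] ltj; last by rewrite L'E //; apply: colset.
  rewrite L'N; case: (zone j) => [|->|ej|hj]; [lia|by rewrite rN0 eqxx|lia|].
  by rewrite rNd // => _; apply: disp.
Qed.
End Smetaniuk.

(** * Partial Latin squares *)

Definition latin (X Y Z : Type) (f : X -> Y -> Z) : Prop :=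
  (forall x, injective (f x)) /\ (forall y, injective (f^~ y)).

Record partial_latin (X Y Z : Type) (P : X -> Y -> option Z) : Prop := {
  pl_row : forall x y y' c, P x y = Some c -> P x y' = Some c -> y = y';
  pl_col : forall x x' y c, P x y = Some c -> P x' y = Some c -> x = x' }.

Definition colored (X Y Z : finType) (P : X -> Y -> option Z) (W : {set Z}) :
  {set X * Y} := [set p | if P p.1 p.2 is Some c then c \in W else false].

Notation filled P := (colored P [set: _]).

Lemma partial_latinT (X Y Z : Type) (P : X -> Y -> option Z) :
  partial_latin P -> partial_latin (fun y x => P x y).
Proof. by case=> row col; split=> x y *; [apply: col|apply: row]; eauto. Qed.

Lemma card_pairs (X Y : finType) (R : X -> Y -> bool) :
  #|[set p : X * Y | R p.1 p.2]| = \sum_x #|[set y | R x y]|.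
Proof.
rewrite -sum1dep_card -(pair_big_dep predT R (fun _ _ => 1)) /=.
by apply: eq_bigr => x _; rewrite sum1dep_card.
Qed.

Lemma card_pairsT (X Y : finType) (R : X -> Y -> bool) :
  #|[set p : X * Y | R p.1 p.2]| = \sum_y #|[set x | R x y]|.
Proof.
rewrite -(card_pairs (fun y x => R x y)).
rewrite -(card_imset (pred_of_set [set p : X * Y | R p.1 p.2])
   (f := fun p => (p.2, p.1))) => [|[a b] [c d] [-> ->]] //.
congr #|pred_of_set _|; apply/setP => -[y x]; apply/imsetP/idP.
  by case=> -[x' y']; rewrite !inE /= => ? [-> ->].
by rewrite inE /= => ?; exists (x, y); rewrite ?inE.
Qed.

Section Colored.
Variables (X Y Z : finType) (P : X -> Y -> option Z).
Implicit Types (W : {set Z}).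

Lemma in_colored W x y :
  ((x, y) \in colored P W) = (if P x y is Some c then c \in W else false).
Proof. by rewrite inE. Qed.

Lemma in_filled x y : ((x, y) \in filled P) = (P x y != None).
Proof. by rewrite inE; case: (P x y) => //= c; rewrite inE. Qed.

Lemma card_colored W : #|colored P W| = \sum_(c in W) #|colored P [set c]|.
Proof.
pose e (p : X * Y) c := (P p.1 p.2 == Some c : bool).
have cE c : #|colored P [set c]| = \sum_p e p c.
  rewrite -sum1dep_card big_mkcond; apply: eq_bigr => p _; rewrite /e.
  by case: (P _ _) => //= c'; rewrite inE.
under eq_bigr => c _ do rewrite cE.
rewrite exchange_big /= -sum1dep_card big_mkcond; apply: eq_bigr => p _.
rewrite /e; case: (P _ _) => [c|] /=; last by rewrite big1.
have eqS c' : (Some c == Some c') = (c == c') by [].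
under eq_bigr => c' _ do rewrite eqS.
case: ifPn => Wc; last first.
  by rewrite big1 // => c' Wc'; case: eqP => // ec; rewrite ec Wc' in Wc.
by rewrite (bigD1 c) //= eqxx big1 // => c' /andP[_]; rewrite eq_sym => /negPf->.
Qed.

Lemma colored_split W : #|filled P| = #|colored P W| + #|colored P (~: W)|.
Proof.
rewrite -(cardsID (colored P W)); congr (_ + _); apply: eq_card => p; rewrite !inE.
  by case: (P _ _) => //= c; rewrite !inE.
by case: (P _ _) => //= c; rewrite !inE andbT.
Qed.
End Colored.

Definition rows_without (X Y Z : finType) (Q : X -> Y -> option Z) (z : Z) :
  {set X} := [set x | [forall y, Q x y != Some z]].

Definition color_complete (X Y Z : Type) (Q : X -> Y -> option Z) (z : Z) :=
  (forall x, exists y, Q x y = Some z) /\ (forall y, exists x, Q x y = Some z).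

(** The cells of color [z] lie in distinct rows, so they are as many as the rows containing [z]. *)
Lemma card_rows_without (X Y Z : finType) (Q : X -> Y -> option Z) (z : Z) :
  partial_latin Q -> #|rows_without Q z| + #|colored Q [set z]| = #|X|.
Proof.
move=> pQ; have e : fst @: colored Q [set z] = ~: rows_without Q z.
  apply/setP => x; rewrite !inE negb_forall; apply/imsetP/existsP.
    case=> -[x' y]; rewrite in_colored => h ->; exists y; rewrite negbK /=.
    by move: h; case: (Q _ _) => // c; rewrite inE => /eqP->.
  by case=> y; rewrite negbK => /eqP e; exists (x, y); rewrite ?in_colored ?e ?inE.
rewrite -(card_in_imset (f := fst)) ?e ?cardsC //.
move=> -[x y] [x' y']; rewrite !in_colored /= => h h' exx; rewrite -exx in h' *.
move: h h'; case E: (Q x y) => [c|] //; case E': (Q x y') => [c'|] //.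
rewrite !inE => /eqP ec /eqP ec'; rewrite ec in E; rewrite ec' in E'.
by rewrite (pl_row pQ E E').
Qed.

(** Hall's theorem for the rows and columns lacking [z], joined when their common cell is empty. A
    set [S] of rows violating Hall's condition spans, with the columns [U] outside its neighborhood,
    a filled rectangle larger than the last hypothesis allows. *)
Lemma extend_color (X Y Z : finType) (Q : X -> Y -> option Z) (z : Z) :
    partial_latin Q -> #|X| = #|Y| ->
    (forall (S : {set X}) (U : {set Y}), S \subset rows_without Q z ->
      U \subset rows_without (fun y x => Q x y) z ->
      {in S & U, forall x y, Q x y <> None} ->
      #|S| + #|U| <= #|rows_without Q z|) ->
  exists Q', [/\ partial_latin Q', color_complete Q' z,
    forall x y c, Q x y = Some c -> Q' x y = Some c &
    forall x y c, Q' x y = Some c -> c <> z -> Q x y = Some c].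
Proof.
move=> pQ cXY noblock.
set A := rows_without Q z in noblock *; set B := rows_without _ z in noblock.
have cAB : #|A| = #|B|.
  have := card_rows_without z pQ; have := card_rows_without z (partial_latinT pQ).
  rewrite -/A -/B cXY => <- /eqP.
  have -> : #|colored (fun y x => Q x y) [set z]| = #|colored Q [set z]|.
    pose R x y := if Q x y is Some c then c \in [set z] else false.
    by rewrite (card_pairs R) (card_pairsT (fun y x => R x y)).
  by rewrite eqn_add2r => /eqP.
have AN x y : x \in A -> Q x y <> Some z.
  by rewrite inE => /forallP/(_ y)/eqP.
have BN x y : y \in B -> Q x y <> Some z.
  by rewrite inE => /forallP/(_ x)/eqP.
have AP x : x \notin A -> exists y, Q x y = Some z.
  by rewrite inE negb_forall => /existsP[y]; rewrite negbK => /eqP; exists y.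
have BP y : y \notin B -> exists x, Q x y = Some z.
  by rewrite inE negb_forall => /existsP[x]; rewrite negbK => /eqP; exists x.
(* [hall] needs an element of [Y]; if there is none, [X] is empty too and [Q] itself serves. *)
have [y0 _|Y0] := pickP (pred_of_simpl (@predT Y)); last first.
  have X0 (x : X) : False.
    have : 0 < #|X| by apply/card_gt0P; exists x.
    by rewrite cXY => /card_gt0P[y]; have := Y0 y.
  by exists Q; split=> //; split=> [x|y]; [case: (X0 x)|have := Y0 y].
pose N x := [set y in B | Q x y == None].
have [S sSA|h injh hN] := @hall X Y y0 A N.
  pose U := B :\: \bigcup_(x in S) N x.
  have := noblock S U sSA (subsetDl _ _); rewrite cAB => H.
  have : #|S| + #|U| <= #|B|.
    apply: H => x y Sx; rewrite !inE => /andP[/bigcupP nU By] e.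
    by apply: nU; exists x => //; rewrite !inE By e eqxx.
  rewrite cardsD; have : #|B :&: \bigcup_(x in S) N x| <= #|\bigcup_(x in S) N x|.
    exact/subset_leq_card/subsetIr.
  have : #|B :&: \bigcup_(x in S) N x| <= #|B| by apply/subset_leq_card/subsetIl.
  lia.
have hB x : x \in A -> h x \in B by move/hN; rewrite inE => /andP[].
have hE x : x \in A -> Q x (h x) = None by move/hN; rewrite inE => /andP[_ /eqP].
have hAB : h @: A = B.
  apply/eqP; rewrite eqEcard (card_in_imset injh) cAB leqnn andbT.
  by apply/subsetP => y /imsetP[x Ax ->]; apply: hB.
pose Q' x y := if (x \in A) && (h x == y) then Some z else Q x y.
have Q'E x y c : Q' x y = Some c ->
    Q x y = Some c \/ [/\ x \in A, h x = y & c = z].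
  rewrite /Q'; case: ifP => [/andP[Ax /eqP hx] [<-]|_]; last by left.
  by right.
exists Q'; split=> //.
- split=> [x y y' c|x x' y c] /Q'E[e|[Ax hx cz]] /Q'E[e'|[Ax' hx' cz']].
  + exact: pl_row e e'.
  + by rewrite cz' in e; case: (AN x y).
  + by rewrite cz in e'; case: (AN x y').
  + by rewrite -hx -hx'.
  + exact: pl_col e e'.
  + by rewrite cz' in e; case: (BN x y) => //; rewrite -hx' hB.
  + by rewrite cz in e'; case: (BN x' y) => //; rewrite -hx hB.
  + by apply: injh; rewrite // hx.
- split=> [x|y].
    have [Ax|/AP[y e]] := boolP (x \in A); last first.
      exists y; rewrite /Q'; case: ifP => // /andP[Ax]; by [].
    by exists (h x); rewrite /Q' Ax eqxx.
  have [|/BP[x e]] := boolP (y \in B).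
    by rewrite -hAB => /imsetP[x Ax ->]; exists x; rewrite /Q' Ax eqxx.
  by exists x; rewrite /Q'; case: ifP => // /andP[Ax].
- move=> x y c e; rewrite /Q'; case: ifP => // /andP[Ax /eqP hx].
  by rewrite -hx hE in e.
- by move=> x y c /Q'E[|[]].
Qed.

(** * Completion when no color occurs exactly once *)

Definition has_color_in (Z : finType) (W : {set Z}) (o : option Z) : bool :=
  if o is Some c then c \in W else false.

Lemma card_row (X Y Z : finType) (Q : X -> Y -> option Z) (D : {set Z}) x :
    partial_latin Q -> {in D, forall c, color_complete Q c} ->
  #|[set y | has_color_in D (Q x y)]| = #|D|.
Proof.
move=> pQ compl; have injS : injective (@Some Z) by move=> ? ? [].
rewrite -(card_imset D injS).
rewrite -(card_in_imset (f := Q x)) => [|y y']; last first.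
  rewrite !inE; case E: (Q x y) => [c|] //= _ _ /esym; exact: pl_row E.
apply: eq_card => o; apply/imsetP/imsetP.
  case=> y; rewrite inE; case E: (Q x y) => [c|] //= Dc ->.
  by exists c.
case=> c Dc ->; have [/(_ x)[y e] _] := compl c Dc; exists y; rewrite ?inE ?e //.
Qed.

(** The [#|K|] completed colors exhaust the [#|K|] cells of each row. *)
Lemma complete_latin (X Y Z : finType) (Q : X -> Y -> option Z) (K : {set Z}) :
    #|X| = #|K| -> #|Y| = #|K| -> partial_latin Q ->
    {in K, forall c, color_complete Q c} ->
  exists f, [/\ latin f, forall x y, f x y \in K &
    forall x y c, c \in K -> Q x y = Some c -> f x y = c].
Proof.
move=> cX cY pQ compl.
have tot x y : {c | c \in K & Q x y == Some c}.
  apply: sig2W; have : [set y | has_color_in K (Q x y)] = setT.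
    by apply/eqP; rewrite eqEcard subsetT card_row // cardsT cY leqnn.
  move/setP/(_ y); rewrite !inE; case: (Q x y) => // c Kc.
  by exists c.
exists (fun x y => s2val (tot x y)); split.
- split=> [x y y'|y x x']; case: (tot _ _) => c /= _ /eqP e;
    case: (tot _ _) => c' /= _ /eqP e' ecc; rewrite -ecc in e'.
  + exact: pl_row pQ _ _ _ _ e e'.
  + exact: pl_col pQ _ _ _ _ e e'.
- by move=> x y; case: (tot x y).
- by move=> x y c Kc e; case: (tot x y) => c' /= _ /eqP; rewrite e => -[].
Qed.

(** Every row and every column has [#|Y| - #|D|] cells without a color of [D]. Those in the rows of
    [S] all lie in columns outside [U]; counting them both ways gives [#|S| <= #|~: U|]. *)
Lemma complete_block (X Y Z : finType) (Q : X -> Y -> option Z) (D : {set Z})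
    (S : {set X}) (U : {set Y}) :
    #|X| = #|Y| -> #|D| < #|Y| -> partial_latin Q ->
    {in D, forall c, color_complete Q c} ->
    {in S & U, forall x y, has_color_in D (Q x y)} -> #|S| + #|U| <= #|Y|.
Proof.
move=> cXY ltD pQ compl block.
pose R x y := (x \in S) && ~~ has_color_in D (Q x y).
have free x : #|[set y | ~~ has_color_in D (Q x y)]| = #|Y| - #|D|.
  rewrite -(card_row x pQ compl) [LHS]cardsCs; congr (_ - _).
  by apply: eq_card => y; rewrite !inE negbK.
have freeT y : #|[set x | ~~ has_color_in D (Q x y)]| = #|Y| - #|D|.
  have compl' : {in D, forall c, color_complete (fun y x => Q x y) c}.
    by move=> c /compl[].
  rewrite -(card_row y (partial_latinT pQ) compl') -cXY [LHS]cardsCs; congr (_ - _).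
  by apply: eq_card => x; rewrite !inE negbK.
have e1 : #|[set p | R p.1 p.2]| = #|S| * (#|Y| - #|D|).
  rewrite card_pairs -sum_nat_const [RHS]big_mkcond; apply: eq_bigr => x _.
  case: ifP => Sx; last by apply: eq_card0 => y; rewrite inE /R Sx.
  by rewrite -(free x); apply: eq_card => y; rewrite !inE /R Sx.
have e2 : #|[set p | R p.1 p.2]| <= #|~: U| * (#|Y| - #|D|).
  rewrite card_pairsT -sum_nat_const [X in _ <= X]big_mkcond.
  apply: leq_sum => y _; rewrite inE; case: ifPn => Uy.
    rewrite -(freeT y); apply: subset_leq_card; apply/subsetP => x.
    by rewrite !inE => /andP[].
  rewrite leqn0 cards_eq0; rewrite negbK in Uy; apply/eqP/setP => x; rewrite !inE /R.
  by apply/negP => /andP[Sx]; rewrite block.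
move: e2; rewrite e1 leq_pmul2r ?subn_gt0 // (cardsCs (~: U)) setCK.
have : #|U| <= #|Y| by apply: max_card.
lia.
Qed.

(** Each row of the filled rectangle holds at most [#|D|] completed colors; its other cells have
    colors outside [D]. *)
Lemma block_bound (X Y Z : finType) (Q : X -> Y -> option Z) (D : {set Z})
    (S : {set X}) (U : {set Y}) :
    partial_latin Q -> {in D, forall c, color_complete Q c} ->
    {in S & U, forall x y, Q x y <> None} ->
  #|S| * #|U| <= #|S| * #|D| + #|colored Q (~: D) :&: setX S U|.
Proof.
move=> pQ compl block; rewrite -cardsX -(cardsID (colored Q (~: D)) (setX S U)).
rewrite (setIC (setX S U)) addnC leq_add2r.
pose R x y := (x \in S) && has_color_in D (Q x y).
apply: leq_trans (_ : #|[set p | R p.1 p.2]| <= _).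
  apply: subset_leq_card; apply/subsetP => -[x y]; rewrite !inE /= /R.
  case/andP=> nD /andP[Sx Uy]; rewrite Sx; move: nD (block x y Sx Uy).
  by case: (Q x y) => //= c; rewrite inE negbK.
rewrite card_pairs -sum_nat_const [X in _ <= X]big_mkcond.
apply: leq_sum => x _; case: ifP => Sx.
  rewrite -(card_row x pQ compl); apply: subset_leq_card; apply/subsetP => y.
  by rewrite !inE /R Sx.
by rewrite leqn0 cards_eq0; apply/eqP/setP => y; rewrite !inE /R Sx.
Qed.

(** The rectangle has sides [m], [u] and [c] cells in later colors, out of [r]; [l] colors are
    completed; the current color occurs [f] times and is missing from [g] rows. Let
    [u <= m = l + t]. Then [t * u <= c], while [2 * l + c <= g < m + u] gives [l + c < t + u]. As
    [l] and [t] are positive, this forces [u = 0], against [m <= g < m + u]. *)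
Lemma block_arith m u l c r f g k : 0 < l -> 2 <= f -> m <= g -> u <= g ->
  g < m + u -> g + f = k -> f + l * f + r <= k -> c <= r ->
  m * u <= m * l + c -> m * u <= u * l + c ->
  False.
Proof.
move=> l0 f2; wlog leum : m u / u <= m => [W|] mg ug gmu gk fk cr b1 b2.
  have [le|/ltnW le] := leqP u m; first exact: (W m u).
  by apply: (W u m le ug mg _ gk fk cr); rewrite ?(mulnC u m) // addnC.
have lf : l * 2 <= l * f by rewrite leq_mul2l f2 orbT.
have ltlm : l < m by lia.
have [t tE] : exists t, m = l + t by exists (m - l); lia.
rewrite tE in leum mg gmu b1 b2 ltlm.
have tu : t * u <= c by lia.
have u1 : u <= 1.
  rewrite leqNgt; apply/negP => lt; have : t * 2 <= t * u by rewrite leq_mul2l lt orbT.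
  lia.
have : u = 0 \/ u = 1 by lia.
by case=> eu; rewrite eu in tu gmu; lia.
Qed.

(** The case with no completed color: [m * u <= c <= r <= a < m + u] leaves only a rectangle of
    width one that contains all remaining cells. *)
Lemma block_arith0 m u c r f a k : m <= a -> u <= a -> a + f = k ->
  f + r <= k -> c <= r -> a < m + u -> m * u <= c ->
  [/\ 0 < m, 0 < u, m = 1 \/ u = 1 & r <= c].
Proof.
move=> ma ua afk frk cr amu muc.
have one : m = 1 \/ u = 1.
  have [m1|m1] := leqP m 1; first by left; lia.
  have [u1|u1] := leqP u 1; first by right; lia.
  have : 2 * u <= m * u by rewrite leq_mul2r m1 orbT.
  have : m * 2 <= m * u by rewrite leq_mul2l u1 orbT.
  lia.
by split=> //; [lia|lia|case: one => e; rewrite e in amu muc; lia].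
Qed.

(* The colors are completed in order of decreasing frequency.  Hall's condition
   could only fail because of a filled rectangle S x U; its cells hold completed
   colors, at most #|D| per row and per column, or are among the few remaining
   cells of [P]. *)
Lemma few_colors (X Y Z : finType) (K : {set Z}) (P : X -> Y -> option Z) :
    #|X| = #|K| -> #|Y| = #|K| -> partial_latin P ->
    (forall x y c, P x y = Some c -> c \in K) ->
    #|filled P| <= #|K| -> (forall c, #|colored P [set c]| <> 1) ->
  exists f, [/\ latin f, forall x y, f x y \in K &
    forall x y c, P x y = Some c -> f x y = c].
Proof.
move=> cX cY pP PK fillP noonce.
pose count c := #|colored P [set c]|.
suff [Q [pQ compl ext]] : exists Q, [/\ partial_latin Q,
    {in K, forall c, color_complete Q c} &
    forall x y c, P x y = Some c -> Q x y = Some c].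
  have [f [lat fK fQ]] := complete_latin cX cY pQ compl.
  by exists f; split=> // x y c e; apply: fQ (ext _ _ _ e); apply: PK e.
(* Loop invariant: [D] collects the most frequent colors, and a color outside [D] occurs in [Q] only
   where [P] has it. *)
suff loop k : k <= #|K| -> exists (D : {set Z}) (Q : X -> Y -> option Z), [/\ D \subset K, #|D| = k,
    {in D & K :\: D, forall d c, count c <= count d} & [/\ partial_latin Q,
    {in D, forall c, color_complete Q c},
    forall x y c, P x y = Some c -> Q x y = Some c &
    forall x y c, Q x y = Some c -> c \notin D -> P x y = Some c]].
  have [D [Q [sDK cD _ [pQ compl ext _]]]] := loop _ (leqnn _).
  have /eqP eDK : D == K by rewrite eqEcard sDK cD leqnn.
  by exists Q; split=> //; rewrite -eDK.
elim: k => [_|k IH ltk].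
  exists set0, P; rewrite sub0set cards0; split=> //; first by move=> d c; rewrite inE.
  by split=> // c; rewrite inE.
have [D [Q [sDK cD mono [pQ compl ext orig]]]] := IH (ltnW ltk).
have [z0 z0KD] : exists z, z \in K :\: D.
  by apply/card_gt0P; rewrite cardsD (setIidPr sDK) cD subn_gt0.
pose z := [arg max_(z > z0 in K :\: D) count z].
have [zKD zmax] : z \in K :\: D /\ {in K :\: D, forall c, count c <= count z}.
  by rewrite /z; case: arg_maxnP => // z1 z1KD h; split=> // c; apply: h.
have [Kz Dz] : z \in K /\ z \notin D by move: zKD; rewrite inE => /andP[].
have colQ (W : {set Z}) : W \subset ~: D -> colored Q W = colored P W.
  move=> sW; apply/setP => -[x y]; rewrite !in_colored.
  case E: (Q x y) => [c|]; last by case E': (P x y) => [c|] //; rewrite (ext _ _ _ E') in E.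
  case E': (P x y) => [c'|].
    by have := ext _ _ _ E'; rewrite E => -[->].
  apply/negP => Wc; have := subsetP sW c Wc; rewrite inE => Dc.
  by rewrite (orig _ _ _ E Dc) in E'.
have szD : [set z] \subset ~: D by rewrite sub1set inE.
have cXY : #|X| = #|Y| by rewrite cX cY.
have [||Q' [pQ' compl' ext' orig']] := extend_color (z := z) pQ => //; last first.
  exists (z |: D), Q'; split.
  - by rewrite subUset sub1set Kz.
  - by rewrite cardsU1 Dz cD.
  - move=> d c; rewrite !inE negb_or => /orP[/eqP->|Dd] /andP[/andP[nz nD] Kc].
      by apply: zmax; rewrite inE nD.
    by apply: mono; rewrite // inE nD.
  split=> //.
  - move=> c; rewrite !inE => /orP[/eqP->//|Dc].
    have [r1 r2] := compl c Dc; split=> [x|y].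
      by have [y e] := r1 x; exists y; apply: ext'.
    by have [x e] := r2 y; exists x; apply: ext'.
  - by move=> x y c /ext; apply: ext'.
  - move=> x y c e; rewrite !inE negb_or => /andP[/eqP nz nD].
    by apply: orig => //; apply: orig' e nz.
move=> S U sS sU block.
have cS := card_rows_without z pQ; have cU := card_rows_without z (partial_latinT pQ).
have cT (W : {set Z}) : #|colored (fun y x => Q x y) W| = #|colored Q W|.
  by rewrite (card_pairs (fun y x => has_color_in W (Q x y)))
     -(card_pairsT (fun x y => has_color_in W (Q x y))).
rewrite cT in cU.
rewrite colQ // in cS cU; rewrite -/(count z) in cS cU.
(* If [z] does not occur in [P], no later color does either, and the rectangle holds completed
   colors only. *)
have [c0|cpos] := posnP (count z).
  rewrite c0 addn0 in cS; rewrite cS cXY.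
  apply: complete_block pQ compl _ => //; first by rewrite cD cY.
  move=> x y Sx Uy; have := block x y Sx Uy; case E: (Q x y) => [c|] //= _.
  apply/negPn/negP => Dc; have e := orig _ _ _ E Dc.
  have : count c <= 0 by rewrite -c0; apply: zmax; rewrite inE Dc (PK _ _ _ e).
  rewrite leqn0 cards_eq0 => /eqP/setP/(_ (x, y)).
  by rewrite in_colored e !inE eqxx.
have c2 : 2 <= count z by have := noonce z; rewrite /count in cpos *; lia.
pose rest := colored P (~: (z |: D)).
have restE : colored Q (~: D) :&: setX S U \subset rest.
  apply/subsetP => -[x y]; rewrite !inE /= => /andP[nD /andP[Sx Uy]].
  case E: (Q x y) nD => [c|] //; rewrite inE => Dc.
  rewrite (orig _ _ _ E Dc) !inE negb_or Dc andbT.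
  apply: contraTneq (subsetP sS x Sx) => cz; rewrite inE negb_forall.
  by apply/existsP; exists y; rewrite negbK E cz.
have b1 := block_bound pQ compl block.
have b2 : #|S| * #|U| <= #|U| * #|D| + #|colored Q (~: D) :&: setX S U|.
  have complT : {in D, forall c, color_complete (fun y x => Q x y) c}.
    by move=> c /compl[].
  have := @block_bound _ _ _ _ D U S (partial_latinT pQ) complT.
  rewrite mulnC => h; apply: leq_trans (h _) _; first by move=> y x Uy Sx; apply: block.
  rewrite leq_add2l.
  pose R x y := [&& has_color_in (~: D) (Q x y), x \in S & y \in U].
  have -> : colored Q (~: D) :&: setX S U = [set p | R p.1 p.2].
    by apply/setP => p; rewrite !inE.
  rewrite card_pairsT -(card_pairs (fun y x => R x y)).
  apply/subset_leq_card/subsetP => p; rewrite !inE /R.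
  by case/andP=> nD /andP[-> ->]; rewrite !andbT; move: nD; case: (Q _ _).
have := subset_leq_card restE; set c' := #|_ :&: _| in b1 b2 * => lec'.
(* Each color of [D] is at least as frequent as [z], so together they take at least
   [(1 + #|D|) * count z] of the at most [#|K|] cells. *)
have sumP : count z + #|D| * count z + #|rest| <= #|K|.
  apply: leq_trans fillP; rewrite (colored_split _ (z |: D)) leq_add2r.
  rewrite card_colored big_setU1 //= leq_add2l -sum_nat_const.
  by apply: leq_sum => d Dd; apply: mono.
have sSA := subset_leq_card sS; have sUB := subset_leq_card sU.
rewrite cX in cS; rewrite cY in cU.
set A := rows_without Q z in sS sSA cS *.
set B := rows_without _ z in sU sUB cU.
rewrite leqNgt; apply/negP => big.
have sUA : #|U| <= #|A| by apply: leq_trans sUB _; rewrite -(leq_add2r (count z)) cS cU.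
have [D0|Dpos] := posnP #|D|; last first.
  exact: block_arith Dpos c2 sSA sUA big cS sumP lec' b1 b2.
(* The rectangle is now part of one row or one column and contains every cell of a color other than
   [z]. Hence the color [w] of its cell [(x, y)] occurs exactly once, against [noonce]. *)
rewrite D0 !muln0 !mul0n !add0n addn0 in b1 b2 sumP.
have [Spos Upos one lerest] := block_arith0 sSA sUA cS sumP lec' big b1.
have [[x Sx] [y Uy]] := (card_gt0P Spos, card_gt0P Upos).
have /eqP eqrest : colored Q (~: D) :&: setX S U == rest.
  by rewrite eqEcard restE.
have PQ x' y' : P x' y' = Q x' y'.
  case E: (Q x' y') => [w|]; last by case E': (P x' y') => [w|] //; rewrite (ext _ _ _ E') in E.
  by apply: orig E _; rewrite (cards0_eq D0) inE.
case E: (Q x y) (block x y Sx Uy) => [w|] // _.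
case: (noonce w); apply/eqP/cards1P; exists (x, y); apply/setP => -[x' y'].
rewrite in_colored PQ inE; apply/idP/eqP => [|[-> ->]]; last by rewrite E inE.
case E': (Q x' y') => [w'|] //; rewrite inE => /eqP ew; rewrite ew in E'.
have : (x', y') \in rest.
  rewrite in_colored PQ E' (cards0_eq D0) !inE orbF.
  apply: contraTneq (subsetP sS x Sx) => wz; rewrite inE negb_forall.
  by apply/existsP; exists y; rewrite negbK E wz.
rewrite -eqrest !inE => /andP[_ /andP[/= Sx' Uy']].
case: one => /eqP/cards1P[v ev].
  move: Sx Sx'; rewrite ev !inE => /eqP xv /eqP xv'; rewrite xv' -xv in E' *.
  by rewrite (pl_row pQ E' E).
move: Uy Uy'; rewrite ev !inE => /eqP yv /eqP yv'; rewrite yv' -yv in E' *.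
by rewrite (pl_col pQ E' E).
Qed.

(** * Moving the filled cells above the antidiagonal *)

(** An arbitrary enumeration corrected by two transpositions; the second one does not move [p]. *)
Lemma number_two (X : finType) (U : {set X}) x1 x2 p q :
    x1 \in U -> x2 \in U -> x1 != x2 -> p < #|U| -> q < #|U| -> p != q ->
  exists rho : X -> nat, [/\ {in U &, injective rho},
    {in U, forall x, rho x < #|U|}, rho x1 = p & rho x2 = q].
Proof.
move=> U1 U2 n12 ltp ltq npq.
pose sw a b i := if i == a then b else if i == b then a else i : nat.
have swI a b : injective (sw a b).
  move=> i j; rewrite /sw.
  case: (eqVneq i a) => ?; case: (eqVneq i b) => ?; case: (eqVneq j a) => ?;
    case: (eqVneq j b) => ?; lia.
have swlt a b k i : a < k -> b < k -> i < k -> sw a b i < k.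
  by rewrite /sw => *; case: ifP => // _; case: ifP.
pose r0 x := index x (enum U).
have r0lt x : x \in U -> r0 x < #|U| by move=> Ux; rewrite cardE index_mem mem_enum.
pose r1 x := sw (r0 x1) p (r0 x).
have r1lt x : x \in U -> r1 x < #|U| by move=> Ux; apply: swlt; rewrite ?r0lt.
have r1inj : {in U &, injective r1}.
  move=> x y Ux Uy /swI /(congr1 (nth x1 (enum U))).
  by rewrite !nth_index ?mem_enum.
have r11 : r1 x1 = p by rewrite /r1 /sw eqxx.
exists (fun x => sw (r1 x2) q (r1 x)); split.
- by move=> x y Ux Uy /swI; apply: r1inj.
- by move=> x Ux; apply: swlt; rewrite ?r1lt.
- rewrite r11 /sw (negPf npq) ifN //; apply: contra_neq n12 => e.
  by apply: r1inj; rewrite // r11 e.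
- by rewrite /sw eqxx.
Qed.

Lemma outside (X : finType) (U V : {set X}) :
  #|V| < #|U| -> exists2 x, x \in U & x \notin V.
Proof.
move=> lt; case: (set_0Vmem (U :\: V)) => [e|[x]]; last first.
  by rewrite inE => /andP[nV Ux]; exists x.
by have := subset_leq_card (_ : U \subset V); rewrite -setD_eq0 e eqxx leqNgt lt => /(_ isT).
Qed.

Definition cells_card (X Y : finType) (T : X -> Y -> bool) :=
  #|[set p : X * Y | T p.1 p.2]|.

(* In the numbering, the cells of [T] lie strictly above the antidiagonal of an
   m x m board and the cell (x0, y0) on it; the rows of [PR] and the columns of
   [PC], which carry colored vertical edges, must not come last, because
   [smetaniuk_extend] does not control the colors of the last row and column. *)
Record staircase (X Y : finType) (m : nat) (U : {set X}) (W : {set Y})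
    (T : X -> Y -> bool) (PR : {set X}) (PC : {set Y}) (x0 : X) (y0 : Y)
    (rho : X -> nat) (gam : Y -> nat) : Prop := {
  st_rinj : {in U &, injective rho};
  st_cinj : {in W &, injective gam};
  st_rlt : {in U, forall x, rho x < m};
  st_clt : {in W, forall y, gam y < m};
  st_cell : forall x y, T x y -> rho x + gam y < m.-1;
  st_marked : rho x0 + gam y0 = m.-1;
  st_PR : {in PR, forall x, rho x < m.-1};
  st_PC : {in PC, forall y, gam y < m.-1} }.

(** The data for which a staircase numbering is sought. The cell [(x0, y0)] is not counted in [T];
    the [maxn] reserves room for it when [PR] and [PC] are empty. *)
Record board (X Y : finType) (m : nat) (U : {set X}) (W : {set Y})
    (T : X -> Y -> bool) (PR : {set X}) (PC : {set Y}) (x0 : X) (y0 : Y) : Prop := {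
  bd_U : #|U| = m;
  bd_W : #|W| = m;
  bd_TU : forall x y, T x y -> x \in U;
  bd_TW : forall x y, T x y -> y \in W;
  bd_PR : PR \subset U;
  bd_PC : PC \subset W;
  bd_x0 : x0 \in U;
  bd_y0 : y0 \in W;
  bd_N : ~~ T x0 y0;
  bd_card : cells_card T + maxn (#|PR| + #|PC|) 1 < m }.

Lemma cells_cardT (X Y : finType) (T : X -> Y -> bool) :
  cells_card (fun y x => T x y) = cells_card T.
Proof. exact: etrans (card_pairs (fun y x => T x y)) (esym (card_pairsT T)). Qed.

Lemma boardT (X Y : finType) m (U : {set X}) (W : {set Y}) T PR PC x0 y0 :
  board m U W T PR PC x0 y0 -> board m W U (fun y x => T x y) PC PR y0 x0.
Proof.
case=> *; split=> //; first by move=> y x; eauto.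
  by move=> y x; eauto.
by rewrite cells_cardT [X in maxn X]addnC.
Qed.

Lemma staircaseT (X Y : finType) m (U : {set X}) (W : {set Y}) T PR PC x0 y0 r g :
  staircase m W U (fun y x => T x y) PC PR y0 x0 g r ->
  staircase m U W T PR PC x0 y0 r g.
Proof. by case=> *; split=> // [x y /=|]; rewrite addnC; auto. Qed.

Lemma cells_card_gt0 (X Y : finType) (T : X -> Y -> bool) x y :
  T x y -> 0 < cells_card T.
Proof. by move=> Txy; apply/card_gt0P; exists (x, y); rewrite inE. Qed.

(** Row [x], which contains a cell, is numbered first, and a column [w] without cells, outside [PC]
    and other than [y0], is numbered last. Deleting both leaves a smaller board with fewer cells;
    shifting its rows by one matches the longer antidiagonal. The last hypothesis guarantees that
    [w] exists. *)
Lemma staircase_step (X Y : finType) m (U : {set X}) (W : {set Y}) T PR PC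
    x0 y0 x y :
    (forall U W T PR PC x0 y0, board m U W T PR PC x0 y0 ->
      exists r g, @staircase X Y m U W T PR PC x0 y0 r g) ->
    board m.+1 U W T PR PC x0 y0 -> T x y -> x != x0 ->
    cells_card T + #|PC| < m ->
  exists r g, staircase m.+1 U W T PR PC x0 y0 r g.
Proof.
move=> IH [cU cW TU TW sPR sPC Ux0 Wy0 N card] Txy nx few.
have [w Ww] : exists2 w, w \in W & w \notin y0 |: PC :|: [set y | [exists x, T x y]].
  apply: outside; rewrite cW.
  apply: leq_ltn_trans (leq_card_setU _ _) _.
  apply: leq_ltn_trans (_ : #|y0 |: PC| + cells_card T < _).
    rewrite leq_add2l; apply: leq_trans (leq_imset_card snd _).
    apply/subset_leq_card/subsetP => v; rewrite inE => /existsP[u Tuv].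
    by apply/imsetP; exists (u, v); rewrite ?inE.
  by rewrite cardsU1; case: (_ \notin _); nat_lia.
rewrite !inE !negb_or negb_exists => /andP[/andP[wy0 wPC] /forallP Tw].
pose T' u v := (u != x) && T u v.
have [|r [g [rinj ginj rlt glt cell mk PRlt PClt]]] :=
  IH (U :\ x) (W :\ w) T' (PR :\ x) PC x0 y0.
  split=> //.
  - by have := cardsD1 x U; rewrite (TU _ _ Txy) cU => -[].
  - by have := cardsD1 w W; rewrite Ww cW => -[].
  - by move=> u v /andP[ux /TU Uu]; rewrite !inE ux.
  - by move=> u v /andP[ux Tuv]; rewrite !inE (TW _ _ Tuv) andbT;
       apply: contraTneq Tuv => ->.
  - exact: setSD.
  - by rewrite subsetD1 sPC.
  - by rewrite !inE eq_sym nx.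
  - by rewrite !inE eq_sym wy0.
  - by rewrite /T' negb_and N orbT.
  have : cells_card T' < cells_card T.
    apply/proper_card/properP; split.
      by apply/subsetP => -[u v]; rewrite !inE => /andP[].
    by exists (x, y); rewrite !inE //= /T' eqxx.
  have : #|PR :\ x| <= #|PR| by apply/subset_leq_card/subsetDl.
  by move: card; rewrite /maxn; case: ifP; case: ifP; nat_lia.
have m0 : 0 < m by apply: leq_ltn_trans few.
exists (fun u => if u == x then 0 else (r u).+1),
       (fun v => if v == w then m else g v).
have rU u : u \in U -> u != x -> u \in U :\ x by rewrite !inE => -> ->.
have gW v : v \in W -> v != w -> v \in W :\ w by rewrite !inE => -> ->.
split=> /=.
- move=> u v Uu Uv; case: (eqVneq u x) => [->|ux]; case: (eqVneq v x) => [->|vx] //.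
  by move=> [] /rinj; apply; apply: rU.
- move=> u v Uu Uv; case: (eqVneq u w) => [->|ux]; case: (eqVneq v w) => [->|vx] //.
  + by move=> e; have := glt v (gW v Uv vx); rewrite -e ltnn.
  + by move=> e; have := glt u (gW u Uu ux); rewrite e ltnn.
  + by apply: ginj; apply: gW.
- by move=> u Uu; case: (eqVneq u x) => // ux; rewrite ltnS rlt ?rU.
- by move=> v Wv; case: (eqVneq v w) => // vw; rewrite ltnS ltnW ?glt ?gW.
- move=> u v Tuv; have vw : v != w by apply: contraTneq Tuv => ->.
  rewrite (negPf vw); case: (eqVneq u x) => [_|ux].
    by rewrite add0n glt ?gW ?(TW _ _ Tuv).
  by have := cell u v; rewrite /T' ux Tuv => /(_ isT); nat_lia.
- by rewrite eq_sym (negPf nx) eq_sym (negPf wy0) addSn mk prednK.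
- move=> u Pu; case: (eqVneq u x) => // ux.
  by have := PRlt u; rewrite !inE ux Pu => /(_ isT); nat_lia.
- move=> v Pv; have vw : v != w by apply: contraTneq Pv => ->.
  by rewrite (negPf vw) glt ?gW ?(subsetP sPC).
Qed.

(** Row [x0] comes first and column [y0] last, so every cell of row [x0] precedes the marked one.
    The last row is taken outside [x0 |: PR]. *)
Lemma staircase_row (X Y : finType) m (U : {set X}) (W : {set Y}) T PR PC x0 y0 :
    board m U W T PR PC x0 y0 -> y0 \notin PC -> (forall x y, T x y -> x = x0) ->
    #|x0 |: PR| < m ->
  exists r g, staircase m U W T PR PC x0 y0 r g.
Proof.
move=> [cU cW TU TW sPR sPC Ux0 Wy0 N card] yPC Trow few.
have m2 : 1 < m by move: card; rewrite /maxn; case: ifP; nat_lia.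
have [x2 Ux2] : exists2 x2, x2 \in U & x2 \notin x0 |: PR.
  by apply: outside; rewrite cU.
rewrite !inE negb_or => /andP[x20 x2PR].
have [y2 Wy2] : exists2 y2, y2 \in W & y2 \notin [set y0].
  by apply: outside; rewrite cW cards1.
rewrite inE => y20.
have [|||r [rinj rlt r0 r2]] := @number_two _ U x2 x0 m.-1 0 Ux2 Ux0 x20;
  rewrite ?cU; [nat_lia..|].
have [|||g [ginj glt g2 g0]] := @number_two _ W y2 y0 0 m.-1 Wy2 Wy0 y20;
  rewrite ?cW; [nat_lia..|].
rewrite cU in rlt; rewrite cW in glt.
have lastg y : y \in W -> y != y0 -> g y < m.-1.
  move=> Wy ny; have := glt y Wy; suff : g y != m.-1 by nat_lia.
  by apply: contra_neq ny => e; apply: ginj; rewrite // g0.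
exists r, g; split=> //.
- move=> x y Txy; have ex := Trow _ _ Txy; rewrite ex r2 add0n.
  apply: lastg; first exact: TW Txy.
  by apply: contraTneq Txy => ->; rewrite ex.
- by rewrite r2 g0.
- move=> x Px; have Ux := subsetP sPR x Px; have := rlt x Ux.
  suff : r x != m.-1 by nat_lia.
  apply: contraTneq Px => e; suff -> : x = x2 by [].
  by apply: rinj; rewrite // r0.
- move=> y Py; apply: lastg; first exact: (subsetP sPC).
  by apply: contraNneq yPC => <-.
Qed.

(** Neither [x0] nor [y0] may come last, so they get the numbers [1] and [m - 2]; a row outside [PR]
    and a column outside [PC] are put last. *)
Lemma staircase_pending (X Y : finType) m (U : {set X}) (W : {set Y}) T PR PC x0 y0 :
    board m U W T PR PC x0 y0 -> (forall x y, ~~ T x y) ->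
    x0 \in PR -> y0 \in PC ->
  exists r g, staircase m U W T PR PC x0 y0 r g.
Proof.
move=> [cU cW TU TW sPR sPC Ux0 Wy0 N card] T0 Px0 Py0.
have p0 : 0 < #|PR| by apply/card_gt0P; exists x0.
have q0 : 0 < #|PC| by apply/card_gt0P; exists y0.
have pq : #|PR| + #|PC| < m by move: card; rewrite /maxn; case: ifP; nat_lia.
have [x2 Ux2 x2PR] : exists2 x2, x2 \in U & x2 \notin PR.
  by apply: outside; rewrite cU; nat_lia.
have [y2 Wy2 y2PC] : exists2 y2, y2 \in W & y2 \notin PC.
  by apply: outside; rewrite cW; nat_lia.
have x20 : x2 != x0 by apply: contraNneq x2PR => ->.
have y20 : y2 != y0 by apply: contraNneq y2PC => ->.
have [|||r [rinj rlt r2 r0]] := @number_two _ U x2 x0 m.-1 1 Ux2 Ux0 x20;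
  rewrite ?cU; [nat_lia..|].
have [|||g [ginj glt g2 g0]] := @number_two _ W y2 y0 m.-1 m.-2 Wy2 Wy0 y20;
  rewrite ?cW; [nat_lia..|].
rewrite cU in rlt; rewrite cW in glt.
exists r, g; split=> //.
- by move=> x y; rewrite (negPf (T0 _ _)).
- by rewrite r0 g0; nat_lia.
- move=> x Px; have Ux := subsetP sPR x Px; have := rlt x Ux.
  suff : r x != m.-1 by nat_lia.
  apply: contraTneq Px => e; suff -> : x = x2 by [].
  by apply: rinj; rewrite // r2.
- move=> y Py; have Wy := subsetP sPC y Py; have := glt y Wy.
  suff : g y != m.-1 by nat_lia.
  apply: contraTneq Py => e; suff -> : y = y2 by [].
  by apply: ginj; rewrite // g2.
Qed.

(** [staircase_row] or its transpose applies unless [x0 \in PR] and [y0 \in PC]. *)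
Lemma staircase_empty (X Y : finType) m (U : {set X}) (W : {set Y}) T PR PC x0 y0 :
    board m U W T PR PC x0 y0 -> (forall x y, ~~ T x y) ->
  exists r g, staircase m U W T PR PC x0 y0 r g.
Proof.
move=> bd T0; have [_ _ _ _ _ _ _ _ _ card] := bd.
have pq : #|PR| + #|PC| < m by move: card; rewrite /maxn; case: ifP; nat_lia.
have m1 : 1 < m by move: card; rewrite /maxn; case: ifP; nat_lia.
have Trow x y : T x y -> x = x0 by rewrite (negPf (T0 x y)).
have Tcol y x : T x y -> y = y0 by rewrite (negPf (T0 x y)).
have [Py0|Py0] := boolP (y0 \in PC); last first.
  have [few|few] := ltnP #|x0 |: PR| m; first exact: staircase_row bd Py0 Trow few.
  rewrite cardsU1 in few.
  have Px0 : x0 \notin PR by move: few; case: (x0 \notin PR) => //=; nat_lia.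
  have few' : #|y0 |: PC| < m.
    by rewrite cardsU1 Py0; move: few; case: (_ \notin _) => /=; nat_lia.
  have [r [g st]] := staircase_row (boardT bd) Px0 Tcol few'.
  by exists g, r; apply: staircaseT.
have [Px0|Px0] := boolP (x0 \in PR); first exact: staircase_pending bd T0 Px0 Py0.
have [|r [g st]] := staircase_row (boardT bd) Px0 Tcol.
  by rewrite cardsU1 Py0 /=; nat_lia.
by exists g, r; apply: staircaseT.
Qed.

(** Induction on [m]. There is room to delete a row if [PR] is nonempty or both [PR] and [PC] are
    empty, and symmetrically for columns. If only [PC] is nonempty, only columns are deleted, until
    all cells lie in column [y0]; then the transpose of [staircase_row] finishes, since [x0] is not
    in [PR]. *)
Lemma staircase_exists (X Y : finType) m (U : {set X}) (W : {set Y}) T PR PC x0 y0 :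
    board m U W T PR PC x0 y0 ->
  exists r g, staircase m U W T PR PC x0 y0 r g.
Proof.
elim: m => [|m IH] in X Y U W T PR PC x0 y0 *.
  by case=> _ _ _ _ _ _ _ _ _; rewrite ltn0.
move=> bd; have [_ _ _ _ _ _ _ _ N card] := bd.
have pq : cells_card T + (#|PR| + #|PC|) < m.+1.
  by move: card; rewrite /maxn; case: ifP; nat_lia.
have t1 : cells_card T < m by move: card; rewrite /maxn; case: ifP; nat_lia.
case: (pickP [pred p : X * Y | T p.1 p.2]) => [[x y] /= Txy|T0]; last first.
  by apply: staircase_empty bd _ => x y; have /= := T0 (x, y) => ->.
have step : forall x y, T x y -> x != x0 -> cells_card T + #|PC| < m ->
    exists r g, staircase m.+1 U W T PR PC x0 y0 r g.
  by move=> u v; apply: staircase_step bd => *; apply: IH.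
have stepT : forall x y, T x y -> y != y0 -> cells_card T + #|PR| < m ->
    exists r g, staircase m.+1 U W T PR PC x0 y0 r g.
  move=> u v Tuv nv few; have [||r [g st]] := staircase_step _ (boardT bd) Tuv nv.
  - by move=> *; apply: IH.
  - by rewrite cells_cardT.
  by exists g, r; apply: staircaseT.
have t0 := cells_card_gt0 Txy.
have [p0|p0] := posnP #|PR|; have [q0|q0] := posnP #|PC|.
- have [ex|nx] := eqVneq x x0; last by apply: step Txy nx _; nat_lia.
  apply: (stepT _ _ Txy); last by nat_lia.
  by apply/eqP => ey; move: N; rewrite -ex -ey Txy.
- case: (pickP [pred p : X * Y | T p.1 p.2 && (p.2 != y0)]) => [[u v]|Tc].
    by case/andP=> /= Tuv nv; apply: stepT Tuv nv _; nat_lia.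
  have Px0 : x0 \notin PR by rewrite (cards0_eq p0) inE.
  have Tcol v u : T u v -> v = y0.
    by move=> Tuv; have := Tc (u, v); rewrite /= Tuv => /negbFE/eqP.
  have few : #|y0 |: PC| < m.+1 by rewrite cardsU1; case: (_ \notin _) => /=; nat_lia.
  have [r [g st]] := staircase_row (boardT bd) Px0 Tcol few.
  by exists g, r; apply: staircaseT.
- case: (pickP [pred p : X * Y | T p.1 p.2 && (p.1 != x0)]) => [[u v]|Tc].
    by case/andP=> /= Tuv nu; apply: step Tuv nu _; nat_lia.
  have Py0 : y0 \notin PC by rewrite (cards0_eq q0) inE.
  have Trow u v : T u v -> u = x0.
    by move=> Tuv; have := Tc (u, v); rewrite /= Tuv => /negbFE/eqP.
  have few : #|x0 |: PR| < m.+1 by rewrite cardsU1; case: (_ \notin _) => /=; nat_lia.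
  exact: staircase_row bd Py0 Trow few.
- have [ex|nx] := eqVneq x x0; last by apply: step Txy nx _; nat_lia.
  apply: (stepT _ _ Txy); last by nat_lia.
  by apply/eqP => ey; move: N; rewrite -ex -ey Txy.
Qed.

(** * Smetaniuk's theorem *)

(* [a x = Some c] (resp. [b y = Some c]) forbids the color [c] in row [x] (resp.
   column [y]): it encodes a vertical edge precolored [c]. *)
Record problem (X Y Z : finType) (K : {set Z}) (P : X -> Y -> option Z)
    (a : X -> option Z) (b : Y -> option Z) : Prop := {
  pb_latin : partial_latin P;
  pb_in : forall x y c, P x y = Some c -> c \in K;
  pb_a_in : forall x c, a x = Some c -> c \in K;
  pb_b_in : forall y c, b y = Some c -> c \in K;
  pb_a : forall x y c, a x = Some c -> P x y <> Some c;
  pb_b : forall x y c, b y = Some c -> P x y <> Some c }.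

Record solution (X Y Z : finType) (K : {set Z}) (P : X -> Y -> option Z)
    (a : X -> option Z) (b : Y -> option Z) (f : X -> Y -> Z) : Prop := {
  sol_latin : latin f;
  sol_in : forall x y, f x y \in K;
  sol_ext : forall x y c, P x y = Some c -> f x y = c;
  sol_a : forall x y c, a x = Some c -> f x y <> c;
  sol_b : forall x y c, b y = Some c -> f x y <> c }.

Definition dom (X Z : finType) (a : X -> option Z) : {set X} :=
  [set x | a x != None].

Lemma numbering (X : finType) m (r : X -> nat) :
    #|X| = m.+1 -> {in [set: X] &, injective r} ->
    {in [set: X], forall x, r x < m.+1} ->
  exists s : nat -> X, (forall x, s (r x) = x) /\ (forall i, i < m.+1 -> r (s i) = i).
Proof.
move=> cX rinj rlt; pose r' x : 'I_m.+1 := inord (r x).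
have rE x : r' x = r x :> nat by rewrite inordK // rlt ?inE.
have r'inj : injective r'.
  by move=> x y /(congr1 val); rewrite /= !rE => /rinj; apply; rewrite inE.
have [s rK sK] : bijective r' by apply: inj_card_bij => //; rewrite card_ord cX.
exists (fun i => s (inord i)); split=> [x|i lti]; first exact: rK.
by rewrite -rE sK inordK.
Qed.

(** A staircase numbering puts the only cell of color [z] on the antidiagonal and the other cells
    above it. The first [N] rows and columns are solved without [z], then enlarged with [z] as the
    new symbol. Rows and columns with a forbidden color are not last, so they gain only [z], which
    is not forbidden. *)
Lemma smetaniuk_step (X Y Z : finType) (K : {set Z}) P a b z N (x0 : X) (y0 : Y) :
    problem K P a b -> #|X| = N.+1 -> #|Y| = N.+1 -> N < #|K| ->
    P x0 y0 = Some z -> #|colored P [set z]| = 1 ->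
    (forall x, a x <> Some z) -> (forall y, b y <> Some z) ->
    #|filled P| + maxn (#|dom a| + #|dom b|) 1 <= N.+1 ->
    (forall (P' : 'I_N -> 'I_N -> option Z) a' b', problem (K :\ z) P' a' b' ->
      #|filled P'| < #|filled P| -> #|dom a'| <= #|dom a| ->
      #|dom b'| <= #|dom b| -> exists f, solution (K :\ z) P' a' b' f) ->
  exists f, solution K P a b f.
Proof.
move=> pb cX cY ltK Pz once az bz card IH.
have [[row col] Kin aK bK Pa Pb] := pb.
have marked x y : P x y = Some z -> x = x0 /\ y = y0.
  move=> e; move/eqP/cards1P: once => [p ep].
  have : (x, y) \in colored P [set z] by rewrite in_colored e inE.
  have : (x0, y0) \in colored P [set z] by rewrite in_colored Pz inE.
  by rewrite ep !inE => /eqP <- /eqP [-> ->].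
have N0 : 0 < N.
  have : 0 < #|filled P| by apply/card_gt0P; exists (x0, y0); rewrite in_filled Pz.
  by move: card; rewrite /maxn; case: ifP; nat_lia.
(* [inord] needs an index type of the form ['I_N.+1]; from here on [N] is one less than in the
   statement. *)
case: N N0 => // N _ in cX cY ltK card IH *.
pose T x y := if P x y is Some c then c != z else false.
have cT : cells_card T < #|filled P|.
  apply/proper_card/properP; split.
    by apply/subsetP => -[x y]; rewrite in_filled inE /T /=; case: (P x y).
  by exists (x0, y0); rewrite ?in_filled ?inE /T /= Pz ?eqxx.
have bd : board N.+2 [set: X] [set: Y] T (dom a) (dom b) x0 y0.
  split; rewrite ?cardsT ?subsetT ?inE //.
    by rewrite /T Pz eqxx.
  by apply: leq_trans card; rewrite -addSn leq_add2r.
have [r [g [rinj ginj rlt glt cell mk PRlt PClt]]] := staircase_exists bd.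
have [s [rK sK]] := numbering cX rinj rlt.
have [t [gK tK]] := numbering cY ginj glt.
rewrite /= in cell mk PRlt PClt.
pose strip o : option Z := if o is Some c then if c == z then None else o else None.
have stripE o c : strip o = Some c <-> o = Some c /\ c <> z.
  case: o => [c'|] /=; last by split=> // -[].
  case: eqP => [->|ne]; first by split=> // -[[<-]].
  by split=> [[<-]|[]].
pose P' (i j : 'I_N.+1) := strip (P (s i) (t j)).
have ltSN (i : 'I_N.+1) : i < N.+2 by apply: ltnW; rewrite ltnS.
have sinj (i j : 'I_N.+1) : s i = s j -> i = j.
  by move/(congr1 r); rewrite !sK ?ltSN // => /val_inj.
have tinj (i j : 'I_N.+1) : t i = t j -> i = j.
  by move/(congr1 g); rewrite !tK ?ltSN // => /val_inj.
have [|||| f [[frow fcol] fK fext fa fb]] :=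
  IH P' (fun i => a (s i)) (fun j => b (t j)).
- split.
  + split=> [i j j' c|i i' j c] /stripE[e _] /stripE[e' _].
      by apply/tinj/row/e'/e.
    by apply/sinj/col/e'/e.
  + by move=> i j c /stripE[e nz]; rewrite !inE (Kin _ _ _ e) andbT; apply/eqP.
  + move=> i c e; rewrite !inE (aK _ _ e) andbT; apply/eqP => ez.
    by rewrite ez in e; case: (az (s i)).
  + move=> i c e; rewrite !inE (bK _ _ e) andbT; apply/eqP => ez.
    by rewrite ez in e; case: (bz (t i)).
  + by move=> i j c e /stripE[e' _]; apply: Pa e e'.
  + by move=> i j c e /stripE[e' _]; apply: Pb e e'.
- apply: leq_ltn_trans cT.
  pose h (p : 'I_N.+1 * 'I_N.+1) := (s p.1, t p.2).
  have hinj : injective h by move=> [i j] [i' j'] [/sinj-> /tinj->].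
  rewrite -(card_imset _ hinj); apply/subset_leq_card/subsetP => q /imsetP[[i j]].
  rewrite in_filled /P' => nN ->; rewrite inE /T /=; move: nN.
  by case: (P _ _) => //= c; case: (c == z).
- rewrite -(card_imset _ sinj); apply/subset_leq_card/subsetP => x /imsetP[i].
  by rewrite !inE => ? ->.
- rewrite -(card_imset _ tinj); apply/subset_leq_card/subsetP => x /imsetP[i].
  by rewrite !inE => ? ->.
pose C i j := f (inord i) (inord j).
have [|||//|//|L [keep diag LNK Lrow [Lcol rowset colset]]] :=
  @smetaniuk_extend Z N.+1 C z _ _ _ K.
- move=> i j j' lti ltj ltj' /frow /(congr1 val); rewrite /= !inordK //.
- move=> j i i' ltj lti lti' /fcol /(congr1 val); rewrite /= !inordK //.
- by move=> i j _ _; have := fK (inord i) (inord j); rewrite !inE => /andP[].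
have CK i j : C i j \in K by have := fK (inord i) (inord j); rewrite !inE => /andP[].
have {}rlt x : r x <= N.+1 by rewrite -ltnS rlt ?inE.
have {}glt y : g y <= N.+1 by rewrite -ltnS glt ?inE.
have lt_or i : i <= N.+1 -> i < N.+1 \/ i = N.+1 by rewrite leq_eqVlt => /orP[/eqP|]; auto.
exists (fun x y => L (r x) (g y)); split.
- split=> [x y y'|y x x'] /=.
    by move/Lrow => /(_ (rlt _) (glt _) (glt _)) /ginj; apply; rewrite inE.
  by move/Lcol => /(_ (glt _) (rlt _) (rlt _)) /rinj; apply; rewrite inE.
- move=> x y; have [->|nz] := eqVneq (L (r x) (g y)) z; first exact: Kin Pz.
  have [ltx|ex] := lt_or _ (rlt x).
    by have [j' _ ->] := rowset _ _ ltx (glt y) nz; apply: CK.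
  have [lty|ey] := lt_or _ (glt y); last by rewrite ex ey.
  by have [i' _ ->] := colset _ _ (rlt x) lty nz; apply: CK.
- move=> x y c e; have [cz|nz] := eqVneq c z.
    rewrite cz in e; have [-> ->] := marked _ _ e.
    have gE : g y0 = N.+1 - r x0 by rewrite -mk addKn.
    by rewrite cz gE diag.
  have lt : r x + g y < N.+1 by apply: cell; rewrite /T e.
  have ltx : r x < N.+1 by apply: leq_ltn_trans lt; apply: leq_addr.
  have lty : g y < N.+1 by apply: leq_ltn_trans lt; apply: leq_addl.
  rewrite keep //; apply: fext; apply/stripE; rewrite !inordK // rK gK.
  by split=> //; apply/eqP.
- move=> x y c e eL; have ltx : r x < N.+1 by apply: PRlt; rewrite inE e.
  have nz : L (r x) (g y) != z by rewrite eL; apply: contra_not_neq (az x) => <-.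
  have [j' _] := rowset _ _ ltx (glt y) nz; rewrite eL => /esym.
  by apply: fa; rewrite inordK // rK.
- move=> x y c e eL; have lty : g y < N.+1 by apply: PClt; rewrite inE e.
  have nz : L (r x) (g y) != z by rewrite eL; apply: contra_not_neq (bz y) => <-.
  have [i' _] := colset _ _ (rlt x) lty nz; rewrite eL => /esym.
  by apply: fb; rewrite inordK // gK.
Qed.

(** The Evans conjecture. A color occurring exactly once is removed by [smetaniuk_step] with nothing
    forbidden; if there is none, [few_colors] applies. *)
Theorem evans (n : nat) (X Y Z : finType) (K : {set Z}) (P : X -> Y -> option Z) :
    #|X| = n -> #|Y| = n -> #|K| = n -> partial_latin P ->
    (forall x y c, P x y = Some c -> c \in K) -> #|filled P| < n ->
  exists f, [/\ latin f, forall x y, f x y \in K &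
    forall x y c, P x y = Some c -> f x y = c].
Proof.
elim: n => // n IH in X Y K P *; move=> cX cY cK pP PK few.
have [z /eqP once|many] := pickP (fun z => #|colored P [set z]| == 1); last first.
  apply: few_colors; rewrite ?cX ?cY ?cK //; first exact: ltnW.
  by move=> c; apply/eqP; rewrite many.
have [[x0 y0] P0] : exists p, p \in colored P [set z].
  by apply/card_gt0P; rewrite once.
have {}P0 : P x0 y0 = Some z.
  by move: P0; rewrite in_colored; case: (P _ _) => // c; rewrite inE => /eqP->.
have d0 (V : finType) : #|dom (fun _ : V => @None Z)| = 0.
  by apply: eq_card0 => x; rewrite inE.
have Kz := PK _ _ _ P0.
suff [f [lat fK ext _ _]] : exists f, solution K P (fun=> None) (fun=> None) f.
  by exists f.
apply: (@smetaniuk_step X Y Z K P _ _ z n x0 y0) => //; first by rewrite cK.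
  by rewrite !d0 addn1.
move=> P' a' b' [lat' PK' _ _ _ _] lt' da db.
have [||||f [lat fK ext]] := IH 'I_n 'I_n (K :\ z) P' _ _ _ lat' PK'.
- by rewrite card_ord.
- by rewrite card_ord.
- by have := cardsD1 z K; rewrite Kz cK => -[].
- exact: leq_trans lt' few.
have none (V : finType) (c : V -> option Z) : #|dom c| <= 0 -> forall v, c v = None.
  rewrite leqn0 cards_eq0 => /eqP/setP dc v; have := dc v; rewrite !inE.
  by case: (c v).
rewrite !d0 in da db; exists f; split=> // x y c.
  by rewrite none.
by rewrite none.
Qed.

(** * Simulating vertical edges by cells *)

(** Edges precolored [z] are left out because [z] is the initial color of every vertical edge. *)
Definition needs_cell (X Z : finType) (z : Z) (a : X -> option Z) : {set X} :=
  [set x | (a x != None) && (a x != Some z)].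

(* [M] holds the cells simulating the vertical edges precolored with a color
   other than [z]. *)
Record swap_cells (X Y Z : finType) (z : Z) (a : X -> option Z)
    (b : Y -> option Z) (M : X -> Y -> option Z) : Prop := {
  sc_row : forall x y y' c c', M x y = Some c -> M x y' = Some c' -> y = y';
  sc_col : forall x x' y c c', M x y = Some c -> M x' y = Some c' -> x = x';
  sc_neq : forall x y c, M x y = Some c -> c <> z;
  sc_a : forall x c, a x = Some c -> c <> z -> exists y, M x y = Some c;
  sc_az : forall x y, a x = Some z -> M x y = None;
  sc_b : forall y c, b y = Some c -> c <> z -> exists x, M x y = Some c;
  sc_bz : forall x y, b y = Some z -> M x y = None;
  sc_card : #|filled M| <= #|needs_cell z a| + #|needs_cell z b|;
  sc_orig : forall x y c, M x y = Some c ->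
    (exists x', a x' = Some c) \/ (exists y', b y' = Some c) }.

Definition clash_free (X Y Z : Type) (P M : X -> Y -> option Z) : Prop :=
  forall x y c, M x y = Some c -> [/\ P x y = None,
    forall y', P x y' <> Some c & forall x', P x' y <> Some c].

Lemma injection_into (X Y : finType) (y0 : Y) (A : {set X}) (B : {set Y}) :
  #|A| <= #|B| -> exists2 s : X -> Y, {in A &, injective s} & {in A, forall x, s x \in B}.
Proof.
move=> le; apply: (@hall X Y y0 A (fun=> B)) => S sSA.
have [->|[x Sx]] := set_0Vmem S; first by rewrite cards0.
apply: leq_trans (subset_leq_card sSA) (leq_trans le _).
by apply/subset_leq_card/subsetP => y By; apply/bigcupP; exists x.
Qed.

Lemma card_touched (X Y Z : finType) (P1 P2 : X -> Y -> option Z) (b : Y -> option Z) :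
  #|[set y | (b y != None) || [exists x, (P1 x y != None) || (P2 x y != None)]]| <=
  #|filled P1| + #|filled P2| + #|dom b|.
Proof.
pose S := dom b :|: snd @: filled P1 :|: snd @: filled P2.
apply: leq_trans (_ : #|S| <= _).
  apply/subset_leq_card/subsetP => y; rewrite !inE.
  case/orP=> [->//|/existsP[x /orP[e|e]]]; apply/orP; [left; apply/orP|]; right.
    by apply/imsetP; exists (x, y); rewrite ?in_filled.
  by apply/imsetP; exists (x, y); rewrite ?in_filled.
apply: leq_trans (leq_card_setU _ _) _.
rewrite addnAC addnC [X in _ <= X]addnC leq_add ?leq_imset_card //.
apply: leq_trans (leq_card_setU _ _) _.
by rewrite addnC leq_add2r leq_imset_card.
Qed.

(** Each row of [A] gets its own column, untouched by [P1], [P2] and [b]; the columns of [B] get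
    rows likewise. At most [#|filled P1| + #|filled P2| + #|dom b|] columns are touched, so enough
    remain for [dom a]. In its own row a cell cannot clash, since its color is forbidden there. *)
Lemma swap_cells_exist (X Y Z : finType) (K : {set Z}) (z : Z)
    (P1 P2 : X -> Y -> option Z) a b (x0 : X) (y0 : Y) :
    #|X| = #|Y| -> problem K P1 a b -> problem K P2 a b ->
    #|filled P1| + #|filled P2| + #|dom a| + #|dom b| <= #|X| ->
  exists M, [/\ swap_cells z a b M, clash_free P1 M & clash_free P2 M].
Proof.
move=> cXY pb1 pb2 card; pose A := needs_cell z a; pose B := needs_cell z b.
pose TY := [set y | (b y != None) || [exists x, (P1 x y != None) || (P2 x y != None)]].
pose TX := [set x | (a x != None) || [exists y, (P1 x y != None) || (P2 x y != None)]].
have cTY : #|TY| <= #|filled P1| + #|filled P2| + #|dom b| by apply: card_touched.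
have cTX : #|TX| <= #|filled P1| + #|filled P2| + #|dom a|.
  apply: leq_trans (card_touched (fun y x => P1 x y) (fun y x => P2 x y) a) _.
  have fT (P : X -> Y -> option Z) : #|filled (fun y x => P x y)| = #|filled P|.
    exact: (cells_cardT (fun x y => has_color_in [set: Z] (P x y))).
  by rewrite !fT.
have sAd : #|A| <= #|dom a|.
  by apply/subset_leq_card/subsetP => x; rewrite !inE => /andP[].
have sBd : #|B| <= #|dom b|.
  by apply/subset_leq_card/subsetP => x; rewrite !inE => /andP[].
have [|s sinj sF] := @injection_into X Y y0 A (~: TY).
  by have := cardsC TY; nat_lia.
have [|t tinj tF] := @injection_into Y X x0 B (~: TX).
  by have := cardsC TX; nat_lia.
have sN x : x \in A -> b (s x) = None /\ forall x', P1 x' (s x) = None /\ P2 x' (s x) = None.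
  move/sF; rewrite !inE negb_or negbK negb_exists => /andP[/eqP-> /forallP h].
  by split=> // x'; have := h x'; rewrite negb_or !negbK => /andP[/eqP-> /eqP->].
have tN y : y \in B -> a (t y) = None /\ forall y', P1 (t y) y' = None /\ P2 (t y) y' = None.
  move/tF; rewrite !inE negb_or negbK negb_exists => /andP[/eqP-> /forallP h].
  by split=> // x'; have := h x'; rewrite negb_or !negbK => /andP[/eqP-> /eqP->].
pose M x y := if (x \in A) && (s x == y) then a x else
  if (y \in B) && (t y == x) then b y else None.
have ME x y c : M x y = Some c ->
    [/\ x \in A, s x = y & a x = Some c] \/ [/\ y \in B, t y = x & b y = Some c].
  rewrite /M; case: ifP => [/andP[Ax /eqP sx] e|_]; first by left.
  by case: ifP => // /andP[By /eqP ty] e; right.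
have Aa x : x \in A -> a x <> None by rewrite inE => /andP[/eqP].
have Bb x : x \in B -> b x <> None by rewrite inE => /andP[/eqP].
have Az x : x \in A -> a x <> Some z by rewrite inE => /andP[_ /eqP].
have Bz x : x \in B -> b x <> Some z by rewrite inE => /andP[_ /eqP].
have inA x c : a x = Some c -> c <> z -> x \in A.
  by move=> e nz; rewrite inE e /=; apply/eqP => -[].
have inB y c : b y = Some c -> c <> z -> y \in B.
  by move=> e nz; rewrite inE e /=; apply/eqP => -[].
exists M; split; first split.
- move=> x y y' c c' /ME[[Ax <- e]|[By tx e]] /ME[[Ax' <- e']|[By' tx' e']] //.
  + by have [] := tN y' By'; rewrite tx' e.
  + by have [] := tN y By; rewrite tx e'.
  + by apply: tinj; rewrite // tx.
- move=> x x' y c c' /ME[[Ax sx e]|[By <- e]] /ME[[Ax' sx' e']|[By' <- e']] //.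
  + by apply: sinj; rewrite // sx.
  + by have [] := sN x Ax; rewrite sx e'.
  + by have [] := sN x' Ax'; rewrite sx' e.
- move=> x y c /ME[[Ax _ e]|[By _ e]] cz; rewrite cz in e.
  + exact: (Az x).
  + exact: (Bz y).
- by move=> x c e nz; exists (s x); rewrite /M (inA _ _ e nz) eqxx.
- move=> x y e; case EM: (M x y) => [c|] //; case/ME: EM => [[/Az]|[/tN[] ]] //.
  by move=> + _ tx; rewrite tx e.
- move=> y c e nz; exists (t y); rewrite /M (inB _ _ e nz) eqxx /=.
  by case: ifP => // /andP[/sN[+ _] /eqP sx]; rewrite sx e.
- move=> x y e; case EM: (M x y) => [c|] //; case/ME: EM => [[/sN[]]|[/Bz]] //.
  by move=> + _ tx; rewrite tx e.
- rewrite -(card_in_imset sinj) -(card_in_imset tinj).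
  pose S1 := [set (x, s x) | x in A]; pose S2 := [set (t y, y) | y in B].
  apply: leq_trans (_ : #|S1 :|: S2| <= _).
    apply/subset_leq_card/subsetP => -[x y]; rewrite in_filled !inE.
    case EM: (M x y) => [c|] // _; apply/orP.
    case/ME: EM => -[h e _]; [left|right]; apply/imsetP.
      by exists x; rewrite ?e.
    by exists y; rewrite ?e.
  apply: leq_trans (leq_card_setU _ _) _.
  rewrite (card_in_imset sinj) (card_in_imset tinj).
  by rewrite leq_add ?leq_imset_card.
- by move=> x y c /ME[[_ _ e]|[_ _ e]]; [left; exists x|right; exists y].
- move=> x y c /ME[[Ax <- e]|[By <- e]]; split.
  + by have [_ /(_ x)[]] := sN x Ax.
  + by move=> y'; apply: pb_a pb1 _ _ _ e.
  + by move=> x'; have [_ /(_ x')[->]] := sN x Ax.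
  + by have [_ /(_ y)[]] := tN y By.
  + by move=> y'; have [_ /(_ y')[->]] := tN y By.
  + by move=> x'; apply: pb_b pb1 _ _ _ e.
- move=> x y c /ME[[Ax <- e]|[By <- e]]; split.
  + by have [_ /(_ x)[]] := sN x Ax.
  + by move=> y'; apply: pb_a pb2 _ _ _ e.
  + by move=> x'; have [_ /(_ x')[_ ->]] := sN x Ax.
  + by have [_ /(_ y)[]] := tN y By.
  + by move=> y'; have [_ /(_ y')[_ ->]] := tN y By.
  + by move=> x'; apply: pb_b pb2 _ _ _ e.
Qed.

Definition overlay (X Y Z : Type) (P M : X -> Y -> option Z) x y :=
  if M x y is Some c then Some c else P x y.

Lemma overlayE (X Y Z : Type) (P M : X -> Y -> option Z) x y c :
  overlay P M x y = Some c -> M x y = Some c \/ P x y = Some c.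
Proof. by rewrite /overlay; case: (M x y); auto. Qed.

Lemma overlay_latin (X Y Z : finType) z a b (P M : X -> Y -> option Z) :
  partial_latin P -> swap_cells z a b M -> clash_free P M ->
  partial_latin (overlay P M).
Proof.
move=> [row col] sc free.
split=> [x y y' c|x x' y c] /(@overlayE X Y Z)[e|e] /(@overlayE X Y Z)[e'|e'].
- exact: sc_row sc _ _ _ _ _ e e'.
- by have [_ /(_ y')] := free _ _ _ e.
- by have [_ /(_ y)] := free _ _ _ e'.
- exact: row e e'.
- exact: sc_col sc _ _ _ _ _ e e'.
- by have [_ _ /(_ x')] := free _ _ _ e.
- by have [_ _ /(_ x)] := free _ _ _ e'.
- exact: col e e'.
Qed.

Lemma filled_overlay (X Y Z : finType) (P M : X -> Y -> option Z) :
  #|filled (overlay P M)| <= #|filled P| + #|filled M|.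
Proof.
apply: leq_trans (leq_card_setU _ _); apply/subset_leq_card/subsetP => -[x y].
by rewrite in_setU !in_filled /overlay; case: (M x y) => [c|]; rewrite ?orbT ?orbF.
Qed.

Lemma overlay_in (X Y Z : finType) (K : {set Z}) z a b (P M : X -> Y -> option Z) :
  problem K P a b -> (forall x y, P x y <> Some z) -> swap_cells z a b M ->
  forall x y c, overlay P M x y = Some c -> c \in K :\ z.
Proof.
move=> pb Pz sc x y c /(@overlayE X Y Z)[e|e]; rewrite !inE.
  rewrite (introF eqP (sc_neq sc e)) /=.
  by case: (sc_orig sc e) => -[v] e'; [apply: pb_a_in pb _ _ e'|apply: pb_b_in pb _ _ e'].
rewrite (pb_in pb e) andbT; apply/eqP => cz.
by rewrite cz in e; case: (Pz x y).
Qed.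

(* Exchanges [z] with the color of each swap cell, along the 4-cycle formed by
   the two copies of the cell and the vertical edges at its two ends; [va] and
   [vb] are the resulting colors of the vertical edges, and depend only on [M]. *)
Lemma swap (X Y Z : finType) (K : {set Z}) z a b (M : X -> Y -> option Z) :
    z \in K -> (forall x y c, M x y = Some c -> c \in K) -> swap_cells z a b M ->
  exists va vb, [/\ forall x c, a x = Some c -> va x = c,
    forall y c, b y = Some c -> vb y = c &
    forall f, latin f -> (forall x y, f x y \in K :\ z) ->
      (forall x y c, M x y = Some c -> f x y = c) ->
    exists g, [/\ latin g, forall x y, g x y \in K,
      forall x y, M x y = None -> g x y = f x y,
      forall x y, g x y <> va x & forall x y, g x y <> vb y]].
Proof.
move=> Kz MK sc.
(* After the exchange a vertical edge carries the color of the swap cell at its end; without such a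
   cell it keeps [z]. *)
pose va x := if [pick c | [exists y, M x y == Some c]] is Some c then c else z.
pose vb y := if [pick c | [exists x, M x y == Some c]] is Some c then c else z.
have vaE x y c : M x y = Some c -> va x = c.
  move=> e; rewrite /va; case: pickP => [c' /existsP[y' /eqP e']|/(_ c)/existsP[]].
    by have ey := sc_row sc e e'; move: e'; rewrite -ey e => -[].
  by exists y; rewrite e.
have vbE x y c : M x y = Some c -> vb y = c.
  move=> e; rewrite /vb; case: pickP => [c' /existsP[y' /eqP e']|/(_ c)/existsP[]].
    by have ex := sc_col sc e e'; move: e'; rewrite -ex e => -[].
  by exists x; rewrite e.
have vaN x : (exists y, M x y = Some (va x)) \/ va x = z /\ forall y, M x y = None.
  rewrite {2}/va; case: pickP => [c /existsP[y /eqP e]|N].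
    by left; exists y; rewrite (vaE _ _ _ e).
  right; split=> // y; case E: (M x y) => [c|] //.
  by have /existsP[] := N c; exists y; rewrite E.
have vbN y : (exists x, M x y = Some (vb y)) \/ vb y = z /\ forall x, M x y = None.
  rewrite {2}/vb; case: pickP => [c /existsP[x /eqP e]|N].
    by left; exists x; rewrite (vbE _ _ _ e).
  right; split=> // x; case E: (M x y) => [c|] //.
  by have /existsP[] := N c; exists x; rewrite E.
exists va, vb; split.
- move=> x c e; have [cz|/eqP nz] := eqVneq c z.
    rewrite cz in e *; case: (vaN x) => [[y e']|[-> _] //].
    by rewrite (sc_az sc _ e) in e'.
  by have [y] := sc_a sc e nz; apply: vaE.
- move=> y c e; have [cz|/eqP nz] := eqVneq c z.
    rewrite cz in e *; case: (vbN y) => [[x e']|[-> _] //].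
    by rewrite (sc_bz sc _ e) in e'.
  by have [x] := sc_b sc e nz; apply: vbE.
move=> f [frow fcol] fK fM.
have fz x y : f x y <> z by have := fK x y; rewrite !inE => /andP[/eqP].
exists (fun x y => if M x y is Some _ then z else f x y); split.
- split=> [x y y'|y x x'] /=.
    case E: (M x y) => [c|]; case E': (M x y') => [c'|].
    + by move=> _; apply: sc_row sc _ _ _ _ _ E E'.
    + by move/esym/fz.
    + by move/fz.
    + exact: frow.
  case E: (M x y) => [c|]; case E': (M x' y) => [c'|].
  + by move=> _; apply: sc_col sc _ _ _ _ _ E E'.
  + by move/esym/fz.
  + by move/fz.
  + exact: fcol.
- move=> x y; case: (M x y) => [_|] //.
  by have := fK x y; rewrite !inE => /andP[].
- by move=> x y ->.
- move=> x y; case: (vaN x) => [[y' e]|[-> ->]]; last exact: fz.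
  case E: (M x y) => [c|] h; first by case: (sc_neq sc e); rewrite h.
  by move: E; rewrite (frow x y y') ?e // (fM _ _ _ e).
- move=> x y; case: (vbN y) => [[x' e]|[-> ->]]; last exact: fz.
  case E: (M x y) => [c|] h; first by case: (sc_neq sc e); rewrite h.
  by move: E; rewrite (fcol y x x') ?e // (fM _ _ _ e).
Qed.

(** * Completion of one and of two copies *)

Lemma problem_empty (X Y Z : finType) (K : {set Z}) (P : X -> Y -> option Z) a b :
  problem K P a b -> problem K (fun (_ : X) (_ : Y) => None) a b.
Proof. by case=> *; split. Qed.

Lemma filled_empty (X Y Z : finType) :
  #|filled (fun (_ : X) (_ : Y) => @None Z)| = 0.
Proof. by apply: eq_card0 => p; rewrite inE. Qed.

Lemma dom0 (X Z : finType) (a : X -> option Z) : #|dom a| = 0 -> forall x, a x = None.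
Proof.
move/eqP; rewrite cards_eq0 => /eqP/setP d x; have := d x; rewrite !inE.
by case: (a x).
Qed.

Lemma filled0 (X Y Z : finType) (P : X -> Y -> option Z) :
  #|filled P| = 0 -> forall x y, P x y = None.
Proof.
move/eqP; rewrite cards_eq0 => /eqP/setP d x y; have := d (x, y).
by rewrite in_filled inE; case: (P x y).
Qed.

Lemma card_values (I Z : finType) (u : I -> option Z) :
  #|[set c | [exists i, u i == Some c]]| <= #|dom u|.
Proof.
have injS : injective (@Some Z) by move=> ? ? [].
rewrite -(card_imset _ injS); apply: leq_trans (leq_imset_card u (dom u)).
apply/subset_leq_card/subsetP => o /imsetP[c]; rewrite inE => /existsP[i /eqP e] ->.
by apply/imsetP; exists i; rewrite ?inE ?e.
Qed.

Lemma dom_uncurry (X Y Z : finType) (P : X -> Y -> option Z) :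
  #|dom (fun p : X * Y => P p.1 p.2)| = #|filled P|.
Proof. by apply: eq_card => -[x y]; rewrite in_filled inE. Qed.

Lemma card_needs_lt (X Z : finType) (z : Z) (a : X -> option Z) x :
  a x = Some z -> #|needs_cell z a| < #|dom a|.
Proof.
move=> e; apply/proper_card/properP; split.
  by apply/subsetP => v; rewrite !inE => /andP[].
by exists x; rewrite !inE e ?eqxx.
Qed.

Lemma card_needs (X Z : finType) (z : Z) (a : X -> option Z) :
  #|needs_cell z a| <= #|dom a|.
Proof. by apply/subset_leq_card/subsetP => v; rewrite !inE => /andP[]. Qed.

Lemma swap_solution (X Y Z : finType) (K : {set Z}) z (P M : X -> Y -> option Z)
    a b f :
    z \in K -> problem K P a b -> swap_cells z a b M -> clash_free P M ->
    latin f -> (forall x y, f x y \in K :\ z) ->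
    (forall x y c, overlay P M x y = Some c -> f x y = c) ->
  exists g, solution K P a b g.
Proof.
move=> Kz pb sc free lat fK ext.
have MK x y c : M x y = Some c -> c \in K.
  by move=> e; case: (sc_orig sc e) => -[v]; [apply: pb_a_in pb v c|apply: pb_b_in pb v c].
have [va [vb [aE bE /(_ f lat fK) [x y c e|g [glat gK gf ga gb]]]]] := swap Kz MK sc.
  by apply: ext; rewrite /overlay e.
exists g; split=> //.
- move=> x y c e; rewrite gf; last first.
    by case E: (M x y) => [c'|] //; have [] := free _ _ _ E; rewrite e.
  apply: ext; rewrite /overlay; case E: (M x y) => [c'|] //.
  by have [] := free _ _ _ E; rewrite e.
- by move=> x y c e; rewrite -(aE _ _ e); apply: ga.
- by move=> x y c e; rewrite -(bE _ _ e); apply: gb.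
Qed.

Theorem pendant_completion (n : nat) (X Y Z : finType) (K : {set Z})
    (P : X -> Y -> option Z) a b :
    #|X| = n -> #|Y| = n -> #|K| = n.+1 -> problem K P a b ->
    #|filled P| + #|dom a| + #|dom b| <= n ->
  exists f, solution K P a b f.
Proof.
elim: n => [|n IH] in X Y K P a b *; move=> cX cY cK pb card.
  have X0 (x : X) : False by have : 0 < #|X| by [apply/card_gt0P; exists x]; rewrite cX.
  exists (fun x => match X0 x with end); split=> //.
  by split=> [x|y x]; case: (X0 x).
have [x0 _] : exists x, x \in X by apply/card_gt0P; rewrite cX.
have [y0 _] : exists y, y \in Y by apply/card_gt0P; rewrite cY.
(* With nothing forbidden, an empty row and an empty column raise the order to the number of colors;
   [evans] completes this array, which is then restricted. *)
have [ab0|abpos] := posnP (#|dom a| + #|dom b|).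
  have a0 := dom0 (a := a) ltac:(nat_lia); have b0 := dom0 (a := b) ltac:(nat_lia).
  pose P' (u : option X) (v : option Y) :=
    if u is Some x then if v is Some y then P x y else None else None.
  have [||||||f [[frow fcol] fK ext]] := @evans n.+2 (option X) (option Y) Z K P'.
  - by rewrite card_option cX.
  - by rewrite card_option cY.
  - by [].
  - have [row col] := pb_latin pb.
    by split=> [[x|] [y|] [y'|] c|[x|] [x'|] [y|] c] //= e e'; congr Some;
      [apply: row e e'|apply: col e e'].
  - by case=> [x|] [y|] c //=; apply: pb_in pb _ _ _.
  - apply: leq_trans (_ : #|filled P|.+1 <= _); last by nat_lia.
    rewrite ltnS; pose h (p : X * Y) := (Some p.1, Some p.2).
    apply: leq_trans (leq_imset_card h _); apply/subset_leq_card/subsetP.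
    move=> [[x|] [y|]]; rewrite in_filled //= => nN.
    by apply/imsetP; exists (x, y); rewrite ?in_filled.
  exists (fun x y => f (Some x) (Some y)); split=> //.
  - by split=> [x y y' /frow[]|y x x' /fcol[]].
  - by move=> x y c e; apply: ext.
  - by move=> x y c; rewrite a0.
  - by move=> x y c; rewrite b0.
have pb0 := problem_empty pb.
pose vertical c := [exists x, a x == Some c] || [exists y, b y == Some c].
have cells z : exists M, swap_cells z a b M /\ clash_free P M.
  have [||M [sc free _]] := @swap_cells_exist _ _ _ K z _ _ _ _ x0 y0 _ pb pb0.
  - by rewrite cX cY.
  - by rewrite filled_empty addn0 cX.
  by exists M.
have vertical_in c : vertical c -> c \in K.
  by case/orP=> /existsP[v /eqP]; [apply: pb_a_in pb v c|apply: pb_b_in pb v c].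
have cKz z : z \in K -> #|K :\ z| = n.+1.
  by move=> Kz; have := cardsD1 z K; rewrite Kz cK => -[].
case: (pickP [pred z | vertical z && [forall p, P p.1 p.2 != Some z]]) => [z|allP].
  case/andP=> vz /forallP Pz; have Kz := vertical_in z vz.
  have {}Pz x y : P x y <> Some z by apply/eqP; apply: (Pz (x, y)).
  have [M [sc free]] := cells z.
  (* A vertical edge precolored [z] needs no swap cell, which brings the overlay below the bound of
     [evans]. *)
  have few : #|needs_cell z a| + #|needs_cell z b| < #|dom a| + #|dom b|.
    have la := card_needs z a; have lb := card_needs z b.
    by case/orP: vz => /existsP[v /eqP /card_needs_lt]; nat_lia.
  have [|f [lat fK ext]] := evans cX cY (cKz z Kz)
     (overlay_latin (pb_latin pb) sc free) (overlay_in pb Pz sc).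
    have := filled_overlay P M; have := sc_card sc; nat_lia.
  exact: swap_solution Kz pb sc free lat fK ext.
have vP c : vertical c -> exists p, P p.1 p.2 = Some c.
  move=> vc; have := allP c; rewrite /= vc /= => /negbT; rewrite negb_forall.
  by case/existsP=> p; rewrite negbK => /eqP e; exists p.
case: (pickP [pred z | (#|colored P [set z]| == 1) && ~~ vertical z]) => [z|once].
  case/andP=> /eqP c1 nv.
  have [[x1 y1] P1] : exists p, p \in colored P [set z].
    by apply/card_gt0P; rewrite c1.
  have {}P1 : P x1 y1 = Some z.
    by move: P1; rewrite in_colored; case: (P _ _) => // c; rewrite inE => /eqP->.
  apply: (@smetaniuk_step X Y Z K P a b z n x1 y1) => //.
  - by rewrite cK.
  - by move=> x e; case/negP: nv; apply/orP; left; apply/existsP; exists x; rewrite e.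
  - by move=> y e; case/negP: nv; apply/orP; right; apply/existsP; exists y; rewrite e.
  - by rewrite (maxn_idPl abpos) addnA.
  - move=> P' a' b' pb' lt la lb; apply: IH pb' _; rewrite ?card_ord //.
      by rewrite cKz // (pb_in pb P1).
    nat_lia.
(* [P] has at most [n] filled cells and there are [n + 2] colors, so some [z] is absent from [P]; by
   [vP] it is on no vertical edge either. *)
have [z Kz nP] : exists2 z, z \in K & z \notin [set c | [exists p : X * Y, P p.1 p.2 == Some c]].
  apply: outside; rewrite cK; apply: leq_ltn_trans (card_values _) _.
  by rewrite dom_uncurry; nat_lia.
have Pz x y : P x y <> Some z.
  by move=> e; case/negP: nP; rewrite inE; apply/existsP; exists (x, y); rewrite /= e.
have [M [sc free]] := cells z.
have PM x y c : P x y = Some c -> overlay P M x y = Some c.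
  move=> e; rewrite /overlay; case E: (M x y) => [c'|] //.
  by have [] := free _ _ _ E; rewrite e.
have [||||f [lat fK ext]] := few_colors (K := K :\ z) _ _
    (overlay_latin (pb_latin pb) sc free) (overlay_in pb Pz sc).
- by rewrite cKz.
- by rewrite cKz.
- rewrite cKz //; have := filled_overlay P M; have := sc_card sc.
  by have := card_needs z a; have := card_needs z b; nat_lia.
(* A vertical color occurs both in [P], by [vP], and on a swap cell, hence at least twice. Any other
   color occurs in the overlay exactly where it does in [P], so not exactly once. *)
- move=> c; have [vc|nvc] := boolP (vertical c).
    have [[x y] /= e] := vP c vc.
    have cz : c <> z by move=> cz; rewrite cz in e; case: (Pz x y).
    have [x' [y' e']] : exists x' y', M x' y' = Some c.
      case/orP: vc => /existsP[v /eqP ev].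
        by have [y' e'] := sc_a sc ev cz; exists v, y'.
      by have [x' e'] := sc_b sc ev cz; exists x', v.
    move=> /eqP/cards1P[p ep].
    have : (x, y) \in colored (overlay P M) [set c] by rewrite in_colored (PM _ _ _ e) inE.
    have : (x', y') \in colored (overlay P M) [set c].
      by rewrite in_colored /overlay e' inE.
    rewrite ep !inE => /eqP <- /eqP[ex ey]; rewrite ex ey in e.
    by have [] := free _ _ _ e'; rewrite e.
  have -> : colored (overlay P M) [set c] = colored P [set c].
    apply/setP => -[x y]; rewrite !in_colored /overlay.
    case E: (M x y) => [c'|] //; have [-> _ _] := free _ _ _ E.
    rewrite inE; apply: contraNF nvc => /eqP ec; rewrite ec in E.
    by apply/orP; case: (sc_orig sc E) => -[v ev]; [left|right];
       apply/existsP; exists v; rewrite ev.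
  by move/eqP=> c1; have := once c; rewrite /= c1 nvc.
exact: swap_solution Kz pb sc free lat fK ext.
Qed.

(** Turns forbidden colors into a full coloring of vertical edges: a row without prescription takes
    some color absent from it, as there are more colors than columns. *)
Lemma missing_color (X Y Z : finType) (K : {set Z}) (f : X -> Y -> Z)
    (a : X -> option Z) :
    #|Y| < #|K| -> (forall x y c, a x = Some c -> f x y <> c) ->
  exists va, (forall x c, a x = Some c -> va x = c) /\ forall x y, f x y <> va x.
Proof.
move=> lt fa.
have miss x : {c : Z | [forall y, f x y != c]}.
  apply: sigW; have [c Kc nf] : exists2 c, c \in K & c \notin f x @: Y.
    apply: outside; apply: leq_ltn_trans lt; exact: leq_imset_card.
  exists c; apply/forallP => y; apply: contraNneq nf => <-.
  by apply/imsetP; exists y.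
exists (fun x => if a x is Some c then c else val (miss x)); split=> [x c ->//|x y].
case E: (a x) => [c|]; first exact: fa E.
by apply/eqP; have /forallP := valP (miss x).
Qed.

(** The edge coloring in array form: each vertical edge joins the two copies of a row or column
    vertex, so its color must be absent from that line in both arrays. *)
Definition copies_solution (X Y Z : finType) (P1 P2 : X -> Y -> option Z)
    (a : X -> option Z) (b : Y -> option Z) : Prop :=
  exists g1 g2 va vb,
  [/\ latin g1, latin g2, forall x c, a x = Some c -> va x = c,
     forall y c, b y = Some c -> vb y = c &
  [/\ forall x y c, P1 x y = Some c -> g1 x y = c,
     forall x y c, P2 x y = Some c -> g2 x y = c,
     forall x y, g1 x y <> va x /\ g2 x y <> va x &
     forall x y, g1 x y <> vb y /\ g2 x y <> vb y]].

Lemma copies_solutionC (X Y Z : finType) (P1 P2 : X -> Y -> option Z) a b :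
  copies_solution P1 P2 a b -> copies_solution P2 P1 a b.
Proof.
move=> [g1 [g2 [va [vb [l1 l2 aE bE [e1 e2 na nb]]]]]].
exists g2, g1, va, vb; split=> //; split=> // x y.
  by have [] := na x y.
by have [] := nb x y.
Qed.

Lemma one_copy (n : nat) (X Y Z : finType) (K : {set Z})
    (P1 P2 : X -> Y -> option Z) a b :
    #|X| = n -> #|Y| = n -> #|K| = n.+1 -> problem K P1 a b ->
    #|filled P1| + #|dom a| + #|dom b| <= n -> #|filled P2| = 0 ->
  copies_solution P1 P2 a b.
Proof.
move=> cX cY cK pb card P20.
have [f [lat fK ext fa fb]] := pendant_completion cX cY cK pb card.
have [|va [aE na]] := @missing_color _ _ _ K f a _ fa; first by rewrite cY cK.
have [|vb [bE nb]] := @missing_color _ _ _ K (fun y x => f x y) b _ (fun y x => fb x y).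
  by rewrite cX cK.
exists f, f, va, vb; split=> //; split=> // x y c.
by rewrite filled0.
Qed.

Theorem copies_completion (n : nat) (X Y Z : finType) (K : {set Z})
    (P1 P2 : X -> Y -> option Z) a b :
    0 < n -> #|X| = n -> #|Y| = n -> #|K| = n.+1 ->
    problem K P1 a b -> problem K P2 a b ->
    #|filled P1| + #|filled P2| + #|dom a| + #|dom b| <= n ->
  copies_solution P1 P2 a b.
Proof.
move=> n0 cX cY cK pb1 pb2 card.
have [P10|p1] := posnP #|filled P1|.
  apply: copies_solutionC; apply: (one_copy cX cY cK pb2 _ P10).
  by rewrite P10 in card.
have [P20|p2] := posnP #|filled P2|.
  apply: (one_copy cX cY cK pb1 _ P20).
  by rewrite P20 addn0 in card.
have [x0 _] : exists x, x \in X by apply/card_gt0P; rewrite cX.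
have [y0 _] : exists y, y \in Y by apply/card_gt0P; rewrite cY.
pose V1 := [set c | [exists p : X * Y, P1 p.1 p.2 == Some c]].
pose V2 := [set c | [exists p : X * Y, P2 p.1 p.2 == Some c]].
have cV1 : #|V1| <= #|filled P1| by rewrite -dom_uncurry card_values.
have cV2 : #|V2| <= #|filled P2| by rewrite -dom_uncurry card_values.
(* The cells of both copies show at most [n] of the [n + 1] colors. *)
have [z Kz] : exists2 z, z \in K & z \notin V1 :|: V2.
  apply: outside; rewrite cK; apply: leq_ltn_trans (leq_card_setU _ _) _.
  by nat_lia.
rewrite inE negb_or => /andP[nV1 nV2].
have P1z x y : P1 x y <> Some z.
  by move=> e; case/negP: nV1; rewrite inE; apply/existsP; exists (x, y); rewrite /= e.
have P2z x y : P2 x y <> Some z.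
  by move=> e; case/negP: nV2; rewrite inE; apply/existsP; exists (x, y); rewrite /= e.
have [||M [sc free1 free2]] := @swap_cells_exist _ _ _ K z _ _ _ _ x0 y0 _ pb1 pb2.
- by rewrite cX cY.
- by rewrite cX.
have cKz : #|K :\ z| = n by have := cardsD1 z K; rewrite Kz cK => -[].
have cM := sc_card sc; have ca := card_needs z a; have cb := card_needs z b.
(* Since the other copy has a filled cell, each overlay fills fewer than [n] cells. *)
have [|f1 [lat1 f1K ext1]] := evans cX cY cKz
   (overlay_latin (pb_latin pb1) sc free1) (overlay_in pb1 P1z sc).
  have := filled_overlay P1 M; nat_lia.
have [|f2 [lat2 f2K ext2]] := evans cX cY cKz
   (overlay_latin (pb_latin pb2) sc free2) (overlay_in pb2 P2z sc).
  have := filled_overlay P2 M; nat_lia.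
have MK x y c : M x y = Some c -> c \in K.
  by move=> e; case: (sc_orig sc e) => -[v]; [apply: pb_a_in pb1 v c|apply: pb_b_in pb1 v c].
(* One choice of [va] and [vb] must fit both completions, so it is fixed before [f1] and [f2] are
   supplied. *)
have [va [vb [aE bE sw]]] := swap Kz MK sc.
have [|g1 [l1 _ g1f g1a g1b]] := sw f1 lat1 f1K.
  by move=> x y c e; apply: ext1; rewrite /overlay e.
have [|g2 [l2 _ g2f g2a g2b]] := sw f2 lat2 f2K.
  by move=> x y c e; apply: ext2; rewrite /overlay e.
have noM P x y c : clash_free P M -> P x y = Some c -> M x y = None.
  by move=> fr e; case E: (M x y) => [c'|] //; have [] := fr _ _ _ E; rewrite e.
exists g1, g2, va, vb; split=> //; split=> // x y c e.
  have N := noM _ _ _ _ free1 e.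
  by rewrite g1f //; apply: ext1; rewrite /overlay N.
have N := noM _ _ _ _ free2 e.
by rewrite g2f //; apply: ext2; rewrite /overlay N.
Qed.

(** * The graph *)

Section Prism.
Variable n : nat.
Local Notation G := (cartesian (complete_bipartite n n) (complete 2)).

(** Coordinates for the edges: the cells of the two copies, then the vertical edges at row and at
    column vertices. *)
Definition edge_index : finType :=
  (('I_n * 'I_n) + ('I_n * 'I_n) + ('I_n + 'I_n))%type.

Definition cell_edge (i : 'I_2) (p : 'I_n * 'I_n) : {set G} :=
  [set ((inl p.1, i) : G); ((inr p.2, i) : G)].

Definition edge_of (t : edge_index) : {set G} :=
  match t with
  | inl (inl p) => cell_edge ord0 p
  | inl (inr p) => cell_edge ord_max p
  | inr v => [set ((v, ord0) : G); ((v, ord_max) : G)]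
  end.

Lemma I2_cases (i : 'I_2) : i = ord0 \/ i = ord_max.
Proof. by case: i => -[|[|//]] h; [left|right]; apply: val_inj. Qed.

Lemma vertex_eq (v w : 'I_n + 'I_n) (i j : 'I_2) :
  (((v, i) : G) == ((w, j) : G)) = (v == w) && (i == j).
Proof. by apply/eqP/andP => [[-> ->]|[/eqP-> /eqP->]]. Qed.

Lemma in_cell_edge i p (v : 'I_n + 'I_n) j :
  (((v, j) : G) \in cell_edge i p) =
    (j == i) && (match v with inl x => x == p.1 | inr y => y == p.2 end).
Proof.
rewrite in_set2 !vertex_eq andbC [X in _ || X]andbC -andb_orr.
by case: v => v; rewrite ?orbF.
Qed.

Lemma in_edge_of t (v : 'I_n + 'I_n) j : (((v, j) : G) \in edge_of t) =
  match t, v with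
  | inl (inl p), inl x => (j == ord0) && (x == p.1)
  | inl (inl p), inr y => (j == ord0) && (y == p.2)
  | inl (inr p), inl x => (j == ord_max) && (x == p.1)
  | inl (inr p), inr y => (j == ord_max) && (y == p.2)
  | inr w, v => v == w
  end.
Proof.
case: t => [[p|p]|w]; [by rewrite in_cell_edge; case: v..|].
rewrite in_set2 !vertex_eq; case: (v == w) => //=.
by case: (I2_cases j) => ->.
Qed.

Lemma edge_of_inj : injective edge_of.
Proof.
move=> t t' /setP e.
have {}e (v : 'I_n + 'I_n) j : (((v, j) : G) \in edge_of t) = (((v, j) : G) \in edge_of t').
  exact: e.
move: e; case: t => [[[x y]|[x y]]|w]; case: t' => [[[x' y']|[x' y']]|w'] e.
- have := e (inl x) ord0; have := e (inr y) ord0.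
  by rewrite !in_edge_of /= !eqxx => /esym/eqP-> /esym/eqP->.
- by have := e (inl x) ord0; rewrite !in_edge_of /= !eqxx.
- by have := e w' ord_max; rewrite !in_edge_of; case: (w') => ? /=; rewrite ?eqxx.
- by have := e (inl x) ord_max; rewrite !in_edge_of /= !eqxx.
- have := e (inl x) ord_max; have := e (inr y) ord_max.
  by rewrite !in_edge_of /= !eqxx => /esym/eqP-> /esym/eqP->.
- by have := e w' ord0; rewrite !in_edge_of; case: (w') => ? /=; rewrite ?eqxx.
- by have := e w ord_max; rewrite !in_edge_of; case: (w) => ? /=; rewrite ?eqxx.
- by have := e w ord0; rewrite !in_edge_of; case: (w) => ? /=; rewrite ?eqxx.
- by have := e w ord0; rewrite !in_edge_of eqxx => /esym/eqP->.
Qed.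

Lemma edges_edge_of e : e \in edges G -> exists t, e = edge_of t.
Proof.
case/imsetP => -[[v i] [w j]]; rewrite inE /= /cartesian_rel /= => h ->.
case/orP: h => /andP[/eqP <- nij].
  exists (inr v); move: nij; rewrite /complete_rel.
  case: (I2_cases i) => ->; case: (I2_cases j) => -> //= _.
  by rewrite setUC.
have [c hc] : exists c, forall p, edge_of (inl (c p)) = cell_edge i p.
  by case: (I2_cases i) => ->; [exists inl|exists inr].
case: v w nij => [x|x] [y|y] //= _.
  by exists (inl (c (x, y))); rewrite hc.
by exists (inl (c (y, x))); rewrite hc setUC.
Qed.

Lemma card_sum_pred (A B : finType) (Q : pred (A + B)) :
  #|[set t | Q t]| = #|[set x | Q (inl x)]| + #|[set y | Q (inr y)]|.
Proof. by rewrite -!sum1dep_card big_sumType. Qed.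

Lemma share_vertex t t' (v : 'I_n + 'I_n) j : ((v, j) : G) \in edge_of t ->
  ((v, j) : G) \in edge_of t' -> t <> t' -> adjacent_edges (edge_of t) (edge_of t').
Proof.
move=> vt vt' ne; apply/andP; split; first by apply/eqP => /edge_of_inj.
by apply/set0Pn; exists (v, j); rewrite inE vt vt'.
Qed.

Lemma adjacent_share t t' : adjacent_edges (edge_of t) (edge_of t') ->
  t <> t' /\ exists v j, ((v, j) : G) \in edge_of t /\ ((v, j) : G) \in edge_of t'.
Proof.
case/andP=> ne /set0Pn[[v j]]; rewrite inE => /andP[vt vt']; split; last by exists v, j.
by move=> e; rewrite e eqxx in ne.
Qed.
End Prism.

Theorem theorem2p5 (n : nat) (hn : 2 <= n)
    (phi : {set cartesian (complete_bipartite n n) (complete 2)} ->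
           option 'I_n.+1)
    (hphi : edge_precoloring phi) (hcard : #|precolored phi| = n) :
  exists f : {set cartesian (complete_bipartite n n) (complete 2)} -> 'I_n.+1,
    proper_edge_coloring f /\ extends f phi.
Proof.
case: hphi => sub proper.
pose psi (t : edge_index n) := phi (edge_of t).
(* Equally precolored edges sharing a vertex coincide. The nontrivial conditions of [problem] are
   instances of this, at a row vertex [inl x] or a column vertex [inr y]. *)
have psiN t t' v j c : psi t = Some c -> psi t' = Some c ->
    ((v, j) : cartesian (complete_bipartite n n) (complete 2)) \in edge_of t ->
    ((v, j) : cartesian (complete_bipartite n n) (complete 2)) \in edge_of t' ->
    t = t'.
  move=> e e' vt vt'; apply/eqP/negPn/negP => /eqP ne.
  have pre u : psi u = Some c -> edge_of u \in precolored phi.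
    by move=> eu; rewrite inE -/(psi u) eu.
  have := proper _ _ (pre _ e) (pre _ e') (share_vertex vt vt' ne).
  by rewrite -/(psi t) -/(psi t') e e' eqxx.
pose P1 x y := psi (inl (inl (x, y))); pose P2 x y := psi (inl (inr (x, y))).
pose a x := psi (inr (inl x)); pose b y := psi (inr (inr y)).
have card : #|filled P1| + #|filled P2| + #|dom a| + #|dom b| <= n.
  rewrite -[X in _ <= X]hcard.
  apply: leq_trans (_ : #|[set t | psi t != None]| <= _); last first.
    rewrite -(card_imset _ (@edge_of_inj n)); apply/subset_leq_card/subsetP.
    by move=> e /imsetP[t]; rewrite !inE => ? ->.
  rewrite !card_sum_pred -addnA; apply: eq_leq; congr (_ + _ + _).
    by apply: eq_card => -[x y]; rewrite in_filled inE.
  by apply: eq_card => -[x y]; rewrite in_filled inE.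
have K1 c : c \in [set: 'I_n.+1] by rewrite inE.
have pb1 : problem [set: 'I_n.+1] P1 a b.
  split=> //.
  - split=> [x y y' c e e'|x x' y c e e'].
      have := psiN _ _ (inl x) ord0 c e e'.
      by rewrite !in_edge_of !eqxx => /(_ isT isT) [].
    have := psiN _ _ (inr y) ord0 c e e'.
    by rewrite !in_edge_of !eqxx => /(_ isT isT) [].
  - move=> x y c e e'; have := psiN _ _ (inl x) ord0 c e e'.
    by rewrite !in_edge_of !eqxx => /(_ isT isT).
  - move=> x y c e e'; have := psiN _ _ (inr y) ord0 c e e'.
    by rewrite !in_edge_of !eqxx => /(_ isT isT).
have pb2 : problem [set: 'I_n.+1] P2 a b.
  split=> //.
  - split=> [x y y' c e e'|x x' y c e e'].
      have := psiN _ _ (inl x) ord_max c e e'.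
      by rewrite !in_edge_of !eqxx => /(_ isT isT) [].
    have := psiN _ _ (inr y) ord_max c e e'.
    by rewrite !in_edge_of !eqxx => /(_ isT isT) [].
  - move=> x y c e e'; have := psiN _ _ (inl x) ord_max c e e'.
    by rewrite !in_edge_of !eqxx => /(_ isT isT).
  - move=> x y c e e'; have := psiN _ _ (inr y) ord_max c e e'.
    by rewrite !in_edge_of !eqxx => /(_ isT isT).
have cK : #|[set: 'I_n.+1]| = n.+1 by rewrite cardsT card_ord.
have [g1 [g2 [va [vb [[r1 c1] [r2 c2] aE bE [e1 e2 na nb]]]]]] :=
  copies_completion (ltnW hn) (card_ord n) (card_ord n) cK pb1 pb2 card.
pose col (t : edge_index n) := match t with
  | inl (inl p) => g1 p.1 p.2 | inl (inr p) => g2 p.1 p.2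
  | inr (inl x) => va x | inr (inr y) => vb y end.
(* [ord0] is a filler off the edges. *)
pose f e := if [pick t | edge_of t == e] is Some t then col t else ord0.
have fE t : f (edge_of t) = col t.
  rewrite /f; case: pickP => [t' /eqP /edge_of_inj -> //|/(_ t)].
  by rewrite eqxx.
exists f; split.
- move=> e e' /edges_edge_of[t ->] /edges_edge_of[t' ->] /adjacent_share.
  case=> ne [v [j []]]; rewrite !fE !in_edge_of => vt vt'; apply/eqP => ec; apply: ne.
  (* At a common row or column vertex, two cells of one copy fall under the Latin property, a cell
     and a vertical edge under [na] or [nb], and cells of different copies cannot meet. *)
  move: vt vt' ec; case: v => v;
    case: t => [[[x y]|[x y]]|w]; case: t' => [[[x' y']|[x' y']]|w'] /=.
  + by move=> /andP[_ /eqP <-] /andP[_ /eqP <-] => /(r1 _ _ _) ->.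
  + by move=> /andP[/eqP-> _] /andP[].
  + by move=> /andP[_ /eqP <-] /eqP <- => /(proj1 (na _ _)).
  + by move=> /andP[/eqP-> _] /andP[].
  + by move=> /andP[_ /eqP <-] /andP[_ /eqP <-] => /(r2 _ _ _) ->.
  + by move=> /andP[_ /eqP <-] /eqP <- => /(proj2 (na _ _)).
  + by move=> /eqP <- /andP[_ /eqP <-] => /esym/(proj1 (na _ _)).
  + by move=> /eqP <- /andP[_ /eqP <-] => /esym/(proj2 (na _ _)).
  + by move=> /eqP <- /eqP <-.
  + by move=> /andP[_ /eqP <-] /andP[_ /eqP <-] => /(c1 _ _ _) ->.
  + by move=> /andP[/eqP-> _] /andP[].
  + by move=> /andP[_ /eqP <-] /eqP <- => /(proj1 (nb _ _)).
  + by move=> /andP[/eqP-> _] /andP[].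
  + by move=> /andP[_ /eqP <-] /andP[_ /eqP <-] => /(c2 _ _ _) ->.
  + by move=> /andP[_ /eqP <-] /eqP <- => /(proj2 (nb _ _)).
  + by move=> /eqP <- /andP[_ /eqP <-] => /esym/(proj1 (nb _ _)).
  + by move=> /eqP <- /andP[_ /eqP <-] => /esym/(proj2 (nb _ _)).
  + by move=> /eqP <- /eqP <-.
move=> e; rewrite inE => nN.
have /edges_edge_of[t et] : e \in edges (cartesian (complete_bipartite n n) (complete 2)).
  by apply: (subsetP sub); rewrite inE.
move: nN; rewrite et fE -/(psi t); case E: (psi t) => [c|] // _; congr Some.
case: t {et} => [[[x y]|[x y]]|[x|y]] in E *; symmetry.
- exact: e1 E.
- exact: e2 E.
- exact: aE E.
- exact: bE E.
Qed.
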